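(* Let $x_1,x_2,\dots$ and $y_1,y_2,\dots$ be infinite sequences of positive real numbers. Let $n\to+\infty$ and let $m=m(n)$ be such that $m/n$ converges to $\gamma_o^2$ for some $\gamma_o>0$. Put $\mu=\sqrt{nm}$. Let $P_{x,m}=\frac1m\sum_{u=1}^m\delta_{x_u}$ and $P_{y,n}=\frac1n\sum_{i=1}^n\delta_{y_i}$ be the empirical distributions of $x_1,\dots,x_m$ and $y_1,\dots,y_n$. Assume that, as $n,m\to+\infty$: (i) $P_{x,m}$ converges weakly to a probability distribution $P_X$ having a finite first moment $a_x:=\int s\,P_X(ds)$, where $a_x>0$, and $\frac1m\sum_{u=1}^m x_u$ converges to $a_x$; (ii) the family of distributions $\{P_{y,n},\ n=1,2,\dots\}$ is uniformly integrable (that is, $\lim_{K\to\infty}\sup_n\int_{s>K}s\,P_{y,n}(ds)=0$) and $\frac1n\sum_{i=1}^n y_i$ converges to some number $a_y>0$. Put $\lambda_s=s\,a_y\gamma_o^{-1}$. Then for each fixed $i=1,2,\dots$ the probability distribution of the degree $d_i$ of vertex $i$ in the affiliation random graph $G'_{n,m}$ (see context) converges weakly to the compound Poisson distribution $\mathcal{CP}(y_ia_x\gamma_o,Q)$, where $Q$ is the discrete probability distribution assigning to the integers $t=0,1,2,\dots$ the probabilities $$Q(\{t\})=\int\frac{s}{a_x}\,e^{-\lambda_s}\frac{\lambda_s^t}{t!}\,P_X(ds).$$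
   Context: For each $n$ and $m$ let $V=\{1,\dots,n\}$, $W=\{1,\dots,m\}$ (regarded as disjoint sets), and let $H_{n,m}$ be the random bipartite graph with bipartition $V\cup W$ whose edges $i\sim u$, $(i,u)\in V\times W$, are present independently with probabilities $$p_{iu}=\frac{y_ix_u}{y_ix_u+\mu},$$ defined by the truncated sequences $y_1,\dots,y_n$ and $x_1,\dots,x_m$. The affiliation random graph $G'_{n,m}$ has vertex set $V$, and two distinct vertices $i,j\in V$ are adjacent in $G'_{n,m}$ iff they have a common neighbour in $H_{n,m}$. Here $\delta_t$ is the unit mass at $t$. For $\lambda\ge0$ and a probability distribution $P_\xi$, $\mathcal{CP}(\lambda,P_\xi)$ denotes the distribution of the random sum $\sum_{k=1}^{\Lambda}\xi_k$, where $\xi_1,\xi_2,\dots$ are i.i.d. with distribution $P_\xi$ and independent of the Poisson random variable $\Lambda$ with mean $\lambda$. *)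

(* Defs.v *)
(* MathComp / MathComp-Analysis *)
From HB Require Import structures.
From mathcomp Require Import all_boot all_order all_algebra.
From mathcomp Require Import all_classical all_reals all_analysis.

Set Implicit Arguments.
Unset Strict Implicit.
Unset Printing Implicit Defensive.

Import Order.TTheory GRing.Theory Num.Theory.
Import numFieldNormedType.Exports.

Local Open Scope classical_set_scope.
Local Open Scope ring_scope.

(* The laws are required to be measures, not probabilities, only so that
   [empirical x 0], the zero measure, is allowed in a sequence. *)
Definition weak_cvg (R : realType) (nu_ : nat -> {measure set R -> \bar R})
    (nu : {measure set R -> \bar R}) : Prop :=
  forall f : R -> R, continuous f -> (exists M : R, forall s, `|f s| <= M) ->
    (\int[nu_ n]_s (f s)%:E)%E @[n --> \oo] --> (\int[nu]_s (f s)%:E)%E.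

Definition empirical (R : realType) (x : nat -> R) (n : nat) :
    {measure set R -> \bar R} :=
  mscale (n%:R^-1)%:nng (msum (fun u => \d_(x u)) n).

Definition uniformly_integrable (R : realType)
    (nu_ : nat -> {measure set R -> \bar R}) : Prop :=
  ereal_sup [set (\int[nu_ n]_(s in `]K, +oo[) s%:E)%E | n in [set n | (0 < n)%N]]
    @[K --> +oo] --> 0%E.

(* Compound Poisson law CP(lam, Pxi): the law of the sum of the first Lam terms
   of an i.i.d. sequence xi with law Pxi that is independent of the Poisson
   variable Lam.  Mutual independence of Lam, xi 0, xi 1, ... is the product
   rule on initial segments: taking some of the sets to be setT gives every
   finite subfamily.  The second argument of [poisson_prob] is a dummy. *)
Definition compound_poisson (R : realType) (lam : R) (Pxi nu : probability R R)
    : Prop :=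
  exists (d : measure_display) (Omega : measurableType d)
    (P : probability Omega R) (Lam : {RV P >-> nat}) (xi : nat -> {RV P >-> R}),
  [/\ forall A, distribution P Lam A = poisson_prob lam 0 A,
      forall k A, measurable A -> distribution P (xi k) A = Pxi A,
      forall (K : nat) (A : set nat) (B : nat -> set R),
        (forall k, measurable (B k)) ->
        P (Lam @^-1` A `&` \bigcap_(k < K) (xi k @^-1` B k)) =
          (P (Lam @^-1` A) * \prod_(k < K) P (xi k @^-1` B k))%E
    & forall A, measurable A ->
        nu A = P [set w | A (\sum_(k < Lam w) xi k w)]].

(* Bipartite graphs on V = 'I_n and W = 'I_m, given by their edge sets, with
   the discrete sigma-algebra. *)
Definition bigraph (n m : nat) := {set 'I_n * 'I_m}.

HB.instance Definition _ n m := Finite.on (bigraph n m).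
HB.instance Definition _ n m := isPointed.Build (bigraph n m) finset.set0.
HB.instance Definition _ n m := @isMeasurable.Build default_measure_display
  (bigraph n m) discrete_measurable discrete_measurable0
  discrete_measurableC discrete_measurableU.

Definition independent_edges (R : realType) (n m : nat)
    (p : 'I_n -> 'I_m -> R) (G : probability (bigraph n m) R) : Prop :=
  (forall i u, G [set h : bigraph n m | (i, u) \in h] = (p i u)%:E) /\
  (forall J : {set 'I_n * 'I_m},
     G [set h : bigraph n m | J \subset h] =
       (\prod_(e in J) G [set h : bigraph n m | e \in h])%E).

Definition edge_prob (R : realType) (y x : nat -> R) (mu : R) {n m : nat}
    (i : 'I_n) (u : 'I_m) : R :=
  y i * x u / (y i * x u + mu).

Definition affiliation_adj (n m : nat) (h : bigraph n m) : rel 'I_n :=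
  fun i j => (i != j) && [exists u, ((i, u) \in h) && ((j, u) \in h)].

(* Degree of vertex i in the affiliation graph; 0 if i is not a vertex, so that
   one index i makes sense for every n. *)
Definition degree (R : realType) (n m i : nat) (h : bigraph n m) : R :=
  if insub i is Some v then #|affiliation_adj h v|%:R else 0.

Lemma measurable_degree (R : realType) (n m i : nat) :
  measurable_fun setT (@degree R n m i).
Proof. by []. Qed.

HB.instance Definition _ (R : realType) (n m i : nat) :=
  isMeasurableFun.Build _ _ _ _ (@degree R n m i) (@measurable_degree R n m i).

(* Main.v *)
(* Fix a vertex [i] and [z] in ]0, 1[.  Let [S] count the pairs [(j, u)], [j <> i],
   such that [u] is a common neighbour of [i] and [j].  The columns of the edge
   indicators are independent, so [E z^S] is an explicit product over [u], which
   is close to [exp (- (y_i / mu) sum_u x_u (1 - exp (- (1 - z) x_u ay / gamma)))];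
   only the map [s |-> |s| exp (- e |s|)], bounded and continuous, has to be
   integrated against the empirical law, so weak convergence gives the limit, the
   generating function of the compound Poisson law at [z].  The degree differs from
   [S] only if [i] and some [j] have two common neighbours, or if [i] is adjacent to
   a [u] with large [x_u]; both are unlikely.  Convergence of the generating
   functions of integer-valued laws yields weak convergence.  The compound Poisson
   variable lives on the unit interval, whose points are expanded into independent
   digits. *)
Require Import Defs.
From HB Require Import structures.
From mathcomp Require Import all_boot all_order all_algebra.
From mathcomp Require Import all_classical all_reals all_analysis.
From mathcomp Require Import measurable_realfun ring lra.

Set Implicit Arguments.
Unset Strict Implicit.
Unset Printing Implicit Defensive.

Import Order.TTheory GRing.Theory Num.Theory.
Import numFieldNormedType.Exports.

Local Open Scope classical_set_scope.
Local Open Scope ring_scope.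

(** * Independent digits and compound Poisson laws *)

(** Only first moments are under control. Uniform integrability still makes the sums of
    [(x_u / mu)^2] and [(y_j / mu)^2] vanish, and these are the errors made when an edge probability
    is replaced by [y_j x_u / mu]. Double common neighbours bring in squares of [x_u] at a larger
    order; a cutoff [K], fixed before [n] grows, removes them. For [y] uniform integrability is
    assumed. For [x] it is extracted from the convergence of the means: the part of the mean that
    [|s| exp (- e |s|)] misses becomes small as [e] tends to 0. One family of test functions thus
    serves both for the tails and for the limiting exponent. The absolute values keep it bounded on
    the negative half-line, where the limit law is shown to have no mass. Generating functions at
    [0 < z < 1] suit this setting because [z^S] lies in the unit interval: discarding a rare event
    costs at most its probability, and no moment of the degree is needed. No mass can escape to
    infinity, because the limit is the generating function of a probability. *)

Section nat_valued.
Context {d : measure_display} {T : measurableType d}.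

Lemma measurable_fun_into_nat (D : T -> nat) :
  (forall j, measurable (D @^-1` [set j])) -> measurable_fun setT D.
Proof.
move=> mD _ A _; rewrite setTI.
rewrite (_ : D @^-1` A = \bigcup_(j in A) (D @^-1` [set j])).
  by apply: bigcup_measurable.
apply/seteqP; split => [w Aw | w [j Aj /= wj]]; first by exists (D w).
by rewrite /= wj.
Qed.

(** Splitting over the countably many values of [D] makes measurable what a random index selects:
    the rest of a digit expansion, or a sum with a random number of terms. *)
Lemma measurable_fun_switch {d' : measure_display} {T' : measurableType d'}
    (D : T -> nat) (h : nat -> T -> T') :
  measurable_fun setT D -> (forall j, measurable_fun setT (h j)) ->
  measurable_fun setT (fun w => h (D w) w).
Proof.
move=> mD mh _ A mA; rewrite setTI.
rewrite (_ : _ @^-1` A = \bigcup_j (D @^-1` [set j] `&` h j @^-1` A)).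
  apply: bigcupT_measurable => j; apply: measurableI.
    by rewrite -[X in measurable X]setTI; exact: mD.
  by rewrite -[X in measurable X]setTI; exact: mh.
apply/seteqP; split => [w Aw | w [j _ [/= wj Aw]]]; first by exists (D w).
by rewrite /= wj.
Qed.

Lemma measurable_fun_from_nat (f : nat -> T) : measurable_fun setT f.
Proof. by []. Qed.

End nat_valued.

Lemma eq_measure_nat {R : realType} (m1 m2 : {measure set nat -> \bar R}) :
  (forall j, m1 [set j] = m2 [set j]) -> forall A, m1 A = m2 A.
Proof.
move=> m12 A; have -> : A = \bigcup_(j in A) [set j].
  by apply/seteqP; split => [j Aj | j [k Ak /= ->]//]; exists j.
have tA : trivIset A (fun j : nat => [set j]).
  by move=> i j _ _ [k [/= <- <-]].
rewrite !measure_bigcup//.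
by apply: eq_eseriesr => j _; exact: m12.
Qed.

Section probability_bounds.
Context {R : realType}.

Lemma bounded_integrable_prob {d} {T : measurableType d} (P : probability T R)
    (f : T -> R) (M : R) :
  measurable_fun setT f -> (forall t, `|f t| <= M) ->
  P.-integrable setT (EFin \o f).
Proof.
move=> mf fM; apply: measurable_bounded_integrable => //.
  by apply: (@le_lt_trans _ _ 1%E); [exact: probability_le1|exact: ltry].
exists M; split; first exact: num_real.
by move=> N MN t _; rewrite /= (le_trans (fM t))// ltW.
Qed.

Lemma cvg_prob_II (p : probability nat R) : fine (p `I_K) @[K --> \oo] --> (1 : R).
Proof.
apply: (fine_cvg (f := fun j => p `I_j)).
rewrite -(probability_setT p) (_ : setT = \bigcup_j `I_j); last first.
  by apply/seteqP; split => // k _; exists k.+1 => /=.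
apply: (@nondecreasing_cvg_mu _ _ _ p (fun j => `I_j)) => //.
by move=> i j ij; apply/subsetPset => k /= /leq_trans; apply.
Qed.

End probability_bounds.

Section scaling.
Context {R : realType}.
Local Notation mu := (@lebesgue_measure R).
Local Notation U := (uniform_prob (@ltr01 R)).

Lemma uniform_prob01E (A : set R) : measurable A -> U A = mu (A `&` `[0, 1]).
Proof.
move=> mA; rewrite /uniform_prob integral_uniform_pdf.
rewrite (eq_integral (fun=> 1%E)); last first.
  move=> u; rewrite inE/= => -[_]; rewrite in_itv/= /uniform_pdf => ->.
  by rewrite subr0 invr1.
rewrite integral_cst ?mul1e//; exact: measurableI.
Qed.

(** The point 1 is null. The half-open interval is the one tiled by the cells of [digit_map]. *)
Lemma uniform_prob01_co (A : set R) : measurable A ->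
  U A = mu (A `&` `[0, 1[).
Proof.
move=> mA; rewrite uniform_prob01E//.
have m01 : measurable (A `&` `[0, 1[) by exact: measurableI.
rewrite -[RHS]adde0 -[in RHS](_ : mu (A `&` [set 1]) = 0%E); last first.
  apply/eqP; rewrite eq_le measure_ge0 andbT -(lebesgue_measure_set1 1).
  by apply: le_measure; rewrite ?inE//; exact: measurableI.
rewrite -measureU//; last 2 first.
- exact: measurableI.
- apply/seteqP; split => [u/= [[_]]|//]; rewrite in_itv/= => /andP[_ u1].
  by case=> _ u1'; rewrite u1' ltxx in u1.
congr (mu _); rewrite -setIUr setUitv1//; last by rewrite bnd_simp ler01.
Qed.

(** The image of Lebesgue measure under [u -> (u - c) / q], divided by [q], gives half-open
    intervals their length, hence is Lebesgue measure. *)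
Lemma lebesgue_scale (c q : R) (B : set R) : 0 < q -> measurable B ->
  mu [set u | B ((u - c) / q)] = (q%:E * mu B)%E.
Proof.
move=> q0 mB; pose g (u : measurableTypeR R) : measurableTypeR R := (u - c) / q.
have mg : measurable_fun setT g.
  by apply: measurable_funM => //; exact: measurable_funB.
have iq0 : 0 <= q^-1 by rewrite invr_ge0 ltW.
pose m := mscale (NngNum iq0) (pushforward mu g).
have : mu B = m mg B.
  apply: lebesgue_measure_unique => // _ [[a b] /= _ <-].
  rewrite /m /mscale/= /pushforward.
  rewrite (_ : g @^-1` _ = `](c + q * a), (c + q * b)]%classic); last first.
    apply/seteqP; split => u /=; rewrite !in_itv/= /g;
    by rewrite ltr_pdivlMr// ler_pdivrMr// ltrBrDl lerBlDl ![q * _]mulrC.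
  rewrite !lebesgue_measure_itv/= !lte_fin ltrD2l ltr_pM2l//.
  case: ifPn => _; last by rewrite mule0.
  rewrite -!EFinB -EFinM; congr EFin.
  by rewrite opprD addrACA subrr add0r -mulrBr mulKf// gt_eqF.
rewrite /m /mscale/= /pushforward => ->.
by rewrite muleA -EFinM divff ?mul1e// gt_eqF.
Qed.

End scaling.

(* A base-[q] expansion on the unit interval: [D] reads off the first digit of a
   uniform point, which has law [q], and [T] drops it, leaving a uniform point
   independent of that digit. *)
Lemma digit_map {R : realType} (q : probability nat R) :
  exists (D : R -> nat) (T : R -> R),
  [/\ measurable_fun setT D, measurable_fun setT T &
    forall A B, measurable B ->
      uniform_prob (@ltr01 R) (D @^-1` A `&` T @^-1` B) =
      (q A * uniform_prob (@ltr01 R) B)%E].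
Proof.
pose U := uniform_prob (@ltr01 R).
(* [[0, 1[] is cut into consecutive cells of length [p j], whose left endpoints are the cumulative
   masses [c j]. *)
pose p j := fine (q [set j]); pose c j := fine (q `I_j).
have pE j : (p j)%:E = q [set j] by rewrite fineK// fin_num_measure.
have cE j : (c j)%:E = q `I_j by rewrite fineK// fin_num_measure.
have p0 j : 0 <= p j by rewrite fine_ge0.
have cS j : c j.+1 = c j + p j.
  apply: EFin_inj; rewrite EFinD !cE pE -measureU//; last first.
    by apply/seteqP; split => [k/= [/[swap] ->]|//]; rewrite ltnn.
  congr (q _); apply/seteqP; split => k /=.
    by rewrite ltnS leq_eqVlt => /orP[/eqP|]; [right|left].
  by case=> [/ltnW|->]; rewrite ltnS.
have c0 : c 0%N = 0.
  apply: EFin_inj; rewrite cE (_ : `I_0 = set0) ?measure0//.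
  by apply/seteqP; split.
have c1 j : c j <= 1 by rewrite -lee_fin cE probability_le1.
have cnd : {homo c : i j / (i <= j)%N >-> i <= j}.
  by apply: homo_leq => [//| i j k|j]; [exact: le_trans|rewrite cS lerDl].
have ccvg : c j @[j --> \oo] --> (1 : R) by exact: cvg_prob_II.
pose I j : set R := `[c j, c j.+1[%classic.
have Iinj i j u : I i u -> I j u -> i = j.
  wlog ij : i j / (i <= j)%N => [hw Ii Ij|].
    by case/orP: (leq_total i j) => ij; [|apply/esym]; apply: hw.
  move: ij; rewrite leq_eqVlt => /orP[/eqP//|ij].
  rewrite /I/= !in_itv/= => /andP[_ ui] /andP[ju _].
  by have := lt_le_trans ui (le_trans (cnd _ _ ij) ju); rewrite ltxx.
have Iex u : 0 <= u < 1 -> exists j, I j u.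
  move=> /andP[u0 u1].
  have [j uj] : exists j, u < c j.
    near \oo => j; exists j; near: j.
    exact: (cvgr_gt _ ccvg).
  have [k ku kmin] := ex_minnP (ex_intro (fun j => u < c j) j uj).
  case: k ku kmin => [|k ku kmin].
    by rewrite c0 ltNge u0.
  exists k; rewrite /I/= in_itv/= ku andbT leNgt; apply/negP => /kmin.
  by rewrite ltnn.
(* Points outside all cells get the default digit 0, so the fibre over 0 is [I 0] together with the
   complement of the cells. *)
pose D u := xget 0%N [set j | I j u].
(* [h j] stretches cell [j] affinely onto [[0, 1[] when [p j > 0]; a cell with [p j = 0] is
   empty. *)
pose h j u : R := (u - c j) / p j.
have DI j u : I j u -> D u = j.
  by move=> Iju; apply: (Iinj _ _ u) => //; rewrite /D; case: xgetP => [k ->|/(_ j)].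
have mI j : measurable (I j) by exact: measurable_itv.
have mD : measurable_fun setT D.
  apply: measurable_fun_into_nat => j.
  have [->|j0] := eqVneq j 0%N; last first.
    rewrite (_ : _ @^-1` _ = I j)//; apply/seteqP; split => u; last exact: DI.
    rewrite /= {1}/D; case: xgetP => [k -> Iku <-//|_ j0'].
    by rewrite j0' eqxx in j0.
  rewrite (_ : _ @^-1` _ = I 0%N `|` ~` \bigcup_j I j); last first.
    apply/seteqP; split => u /=.
      rewrite {1}/D; case: xgetP => [k -> Iku <-//|nI _]; first by left.
      by right => -[k _ Iku]; apply: (nI k).
    case=> [/DI//|nI]; rewrite /D; case: xgetP => // k _ Iku.
    by exfalso; apply: nI; exists k.
  apply: measurableU => //; apply: measurableC.
  exact: bigcupT_measurable.
have mh j : measurable_fun setT (h j).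
  by apply: measurable_funM => //; exact: measurable_funB.
have mT : measurable_fun setT (fun u => h (D u) u) by exact: measurable_fun_switch.
exists D, (fun u => h (D u) u); split => // A B mB.
have UB0 : 0 <= fine (U B) by rewrite fine_ge0.
have UBE : (fine (U B))%:E = U B by rewrite fineK// fin_num_measure.
(* For fixed [B] both sides are measures in [A] on [nat], so it is enough to compare them on
   singletons. *)
pose m2 := mscale (NngNum UB0) q.
have mTB : measurable ((fun u => h (D u) u) @^-1` B).
  by rewrite -[X in measurable X]setTI; exact: mT.
pose m1 := pushforward (mrestr U mTB) D.
suff E j : m1 [set j] = m2 [set j].
  have /(_ mD) := eq_measure_nat (m1 := m1) (m2 := m2) E A.
  rewrite /m1 /m2 /pushforward/= /mrestr /mscale/= UBE.
  by rewrite [in RHS]muleC.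
rewrite /m1 /m2 /pushforward/= /mrestr /mscale/= UBE /U.
have mDj : measurable (D @^-1` [set j]).
  by rewrite -[X in measurable X]setTI; exact: mD.
rewrite uniform_prob01_co; last exact: measurableI.
rewrite (_ : _ `&` `[0, 1[ = I j `&` [set u | B (h j u)]); last first.
  apply/seteqP; split => u /=.
    move=> [[Dj]]; rewrite Dj => Bh; rewrite in_itv/= => /Iex[k Iku].
    by rewrite -{1}Dj (DI _ _ Iku).
  move=> [Iju Bh]; rewrite (DI _ _ Iju); split; first by split.
  move: Iju; rewrite /I/= !in_itv/= => /andP[ju uj].
  by rewrite (le_trans _ ju) -?c0 ?cnd// (lt_le_trans uj).
have [pj0|pj0] := eqVneq (p j) 0.
  rewrite -pE pj0 mule0 /I cS pj0 addr0.
  by rewrite set_itvco0 ?set0I ?measure0.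
have pj1 : 0 < p j by rewrite lt_neqAle eq_sym pj0 p0.
rewrite -pE muleC uniform_prob01_co// -(lebesgue_scale (c j) pj1); last first.
  exact: measurableI.
congr (lebesgue_measure _); apply/seteqP; split => u /=;
  rewrite /I/= !in_itv/= cS.
  move=> [/andP[ju uj] Bh]; split => //.
  by rewrite divr_ge0 ?subr_ge0//= ltr_pdivrMr// mul1r ltrBlDl.
move=> [Bh]; rewrite ltr_pdivrMr// mul1r ltrBlDl => /andP[ju ->]; split => //.
by move: ju; rewrite ler_pdivlMr// mul0r subr_ge0 => ->.
Unshelve. all: by end_near.
Qed.

Definition natR (R : realType) (k : nat) : R := k%:R.

HB.instance Definition _ (R : realType) := isMeasurableFun.Build _ _ _ _ (natR R)
  (measurable_fun_from_nat (natR R)).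

Section nat_integral.
Context {R : realType}.

Lemma integral_nat (m : {measure set nat -> \bar R}) (f : nat -> \bar R) :
  (forall k, 0 <= f k)%E ->
  (\int[m]_k f k = \sum_(k <oo) (m [set k] * f k))%E.
Proof.
move=> f0; rewrite (_ : setT = \bigcup_k [set k]); last first.
  by apply/seteqP; split => // k _; exists k.
rewrite ge0_integral_bigcup//; last by move=> i j _ _ [k [/= <- <-]].
apply: eq_eseriesr => k _.
rewrite (eq_integral (fun=> f k)); last by move=> j; rewrite inE/= => ->.
by rewrite integral_cst// muleC.
Qed.

Lemma poisson_prob1 (lam : R) k : 0 < lam ->
  poisson_prob lam 0 [set k] = (lam ^+ k / k`!%:R * expR (- lam))%:E.
Proof.
move=> lam0; rewrite /poisson_prob lam0 esum_set1.
  by rewrite /poisson_pmf lam0.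
by rewrite lee_fin poisson_pmf_ge0.
Qed.

Lemma nneseries_expR (c x : R) : 0 <= c -> 0 <= x ->
  (\sum_(k <oo) (c * (x ^+ k / k`!%:R))%:E = (c * expR x)%:E)%E.
Proof.
move=> c0 x0; apply/cvg_lim => //.
have -> : (fun n => \sum_(0 <= k < n) (c * (x ^+ k / k`!%:R))%:E)%E =
    EFin \o (fun n => c * series (exp_coeff x) n).
  apply/funext => n; rewrite /= sumEFin /series/= mulr_sumr.
  by congr EFin; apply: eq_bigr => k _; rewrite /exp_coeff.
apply: cvg_EFin; first by near=> n.
apply: cvgMr; exact: is_cvg_series_exp_coeff.
Unshelve. all: by end_near.
Qed.

Lemma pgf_poisson (lam s : R) : 0 < lam -> 0 <= s ->
  (\int[poisson_prob lam 0]_k (s ^+ k)%:E = (expR (- (lam * (1 - s))))%:E)%E.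
Proof.
move=> lam0 s0; rewrite integral_nat; last by move=> k; rewrite lee_fin exprn_ge0.
rewrite (eq_eseriesr (g := fun k => (expR (- lam) * ((lam * s) ^+ k / k`!%:R))%:E)).
  rewrite nneseries_expR ?expR_ge0 ?mulr_ge0 ?(ltW lam0)//.
  by rewrite -expRD; congr (expR _)%:E; ring.
move=> k _; rewrite [X in (X * _)%E](poisson_prob1 k lam0) -EFinM; congr EFin.
by rewrite exprMn; ring.
Qed.

End nat_integral.

(** An identity that only retypes: it turns the uniform law into a [probability R R] with the same
    values on sets. *)
Definition of_measurableTypeR (R : realType) : measurableTypeR R -> R := idfun.

Lemma measurable_of_measurableTypeR (R : realType) :
  measurable_fun setT (@of_measurableTypeR R).
Proof. exact: measurable_id. Qed.

HB.instance Definition _ (R : realType) := isMeasurableFun.Build _ _ _ _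
  (@of_measurableTypeR R) (@measurable_of_measurableTypeR R).

Definition uniform01 (R : realType) : probability R R :=
  distribution (uniform_prob (@ltr01 R)) (@of_measurableTypeR R).

Section compound.
Context {R : realType}.
Local Notation U := (uniform01 R).

(** Rectangles determine a product measure, so [(D u, T u)] has the law of a [q]-digit and an
    independent uniform point; Tonelli does the rest. *)
Lemma digit_integral (q : probability nat R) (D : R -> nat) (T : R -> R)
    (F : nat -> R -> \bar R) :
  measurable_fun setT D -> measurable_fun setT T ->
  (forall A B, measurable B -> U (D @^-1` A `&` T @^-1` B) = (q A * U B)%E) ->
  (forall k, measurable_fun setT (F k)) -> (forall k u, 0 <= F k u)%E ->
  (\int[U]_u F (D u) (T u) = \int[q]_k \int[U]_u F k u)%E.
Proof.
move=> mD mT DT mF F0.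
pose G (ku : nat * R) := F ku.1 ku.2.
have mG : measurable_fun setT G.
  apply: (measurable_fun_switch (D := fst) (h := fun k (ku : nat * R) => F k ku.2)).
    exact: measurable_fst.
  by move=> k; apply: measurableT_comp => //; exact: measurable_snd.
have mDT : measurable_fun setT (fun u => (D u, T u)) by exact: measurable_fun_pair.
rewrite -[RHS](@fubini_tonelli1 _ _ _ _ _ q U G)//; last first.
  by move=> ?; exact: F0.
transitivity (\int[pushforward U (fun u => (D u, T u))]_ku G ku)%E.
  apply/esym; apply: (ge0_integral_pushforward mDT U measurableT mG) => ? _.
  exact: F0.
apply: eq_measure_integral => A mA _; apply/esym.
apply: (product_measure_unique (m' := pushforward U (fun u => (D u, T u)))) => //.
by move=> B C mB mC; rewrite /pushforward -DT.
Qed.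

Variables (lam : R) (q : probability nat R).
Hypothesis lam_gt0 : 0 < lam.

(** Two expansions are chained: one digit with Poisson law gives the number of terms, and the
    remainder, uniform and independent of it, is expanded with digit law [q] to give the jumps. *)
Lemma compound_poisson_exists : exists c : probability nat R,
  compound_poisson lam (distribution q (natR R)) (distribution c (natR R)) /\
  forall z, 0 <= z <= 1 ->
    (\int[c]_k (z ^+ k)%:E =
     (expR (- (lam * (1 - fine (\int[q]_k (z ^+ k)%:E)))))%:E)%E.
Proof.
have [L [T0 [mL mT0 LT0]]] := digit_map (poisson_prob lam 0).
have [D [T [mD mT DT0]]] := digit_map q.
have DT A B : measurable B ->
  U (D @^-1` A `&` T @^-1` B) = (q A * U B)%E := DT0 A B.
have miT k : measurable_fun setT (iter k T).
  by elim: k => [|k ih]; [exact: measurable_id | exact: measurableT_comp].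
pose X k u := D (iter k T u).
have mX k : measurable_fun setT (X k) by exact: measurableT_comp.
pose S l u := (\sum_(k < l) X k u)%N.
(* The sum is unrolled from its first digit, the form in which [digit_integral] can integrate that
   digit out. *)
have SS l u : S l.+1 u = (D u + S l (T u))%N.
  rewrite /S big_ord_recl; congr addn; apply: eq_bigr => k _.
  by rewrite /X lift0 iterSr.
have mS l : measurable_fun setT (S l).
  elim: l => [|l ih].
    rewrite (_ : S 0%N = cst 0%N); first exact: measurable_cst.
    by apply/funext => u; rewrite /S big_ord0.
  rewrite (_ : S l.+1 = fun u => (D u + S l (T u))%N); last exact/funext/SS.
  apply: (measurable_fun_switch (D := D) (h := fun k u => (k + S l (T u))%N)) => //.
  move=> k; apply: (measurableT_comp (f := fun j : nat => (k + j)%N)) => //.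
  exact: measurableT_comp.
pose W u := S (L u) (T0 u).
have mW : measurable_fun setT W.
  apply: (measurable_fun_switch (D := L) (h := fun k u => S k (T0 u))) => // k.
  exact: measurableT_comp.
pose Lf : {RV U >-> nat} := HB.pack L (isMeasurableFun.Build _ _ _ _ L mL).
pose Wf : {RV U >-> nat} := HB.pack W (isMeasurableFun.Build _ _ _ _ W mW).
pose xi k u : R := (X k (T0 u))%:R.
have mxi k : measurable_fun setT (xi k).
  apply: (measurableT_comp (f := fun j : nat => j%:R : R)) => //.
  exact: measurableT_comp.
pose xif k : {RV U >-> R} := HB.pack (xi k) (isMeasurableFun.Build _ _ _ _ (xi k) (mxi k)).
have pre d (Y : measurableType d) (f : R -> Y) A :
    measurable_fun setT f -> measurable A -> measurable (f @^-1` A).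
  by move=> mf mA; rewrite -[X in measurable X]setTI; exact: mf.
have T0U B : measurable B -> U (T0 @^-1` B) = U B.
  by move=> mB; have := LT0 setT B mB; rewrite preimage_setT setTI probability_setT mul1e.
have TU B : measurable B -> U (T @^-1` B) = U B.
  by move=> mB; have := DT setT B mB; rewrite preimage_setT setTI probability_setT mul1e.
have LU A : U (L @^-1` A) = poisson_prob lam 0 A.
  by have := LT0 A setT measurableT; rewrite preimage_setT setIT probability_setT mule1.
have DU A : U (D @^-1` A) = q A.
  by have := DT A setT measurableT; rewrite preimage_setT setIT probability_setT mule1.
have XU k A : U (X k @^-1` A) = q A.
  elim: k => [|k <-]; first exact: DU.
  rewrite -(TU (X k @^-1` A)); last exact: pre.
  congr (U _).
  by apply/seteqP; split => u /=; rewrite /X iterSr.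
have mcap K (A : nat -> set nat) : measurable (\bigcap_(k < K) (X k @^-1` A k)).
  by apply: bigcap_measurableType => k _; exact: pre.
(* Independence of the digits by peeling: the conditions on all later digits form one event about
   [T u]. *)
have capU K (A : nat -> set nat) :
    U (\bigcap_(k < K) (X k @^-1` A k)) = (\prod_(k < K) q (A k))%E.
  elim: K A => [|K ih] A.
    by rewrite big_ord0 (_ : `I_0 = set0) ?bigcap_set0 ?probability_setT// -subset0.
  rewrite big_ord_recl -(ih (fun k => A k.+1)) -DT//; congr (U _).
  apply/seteqP; split => u /=.
    move=> H; split; first by have := H 0%N isT.
    by move=> k /= kK; rewrite /X -iterSr; exact: (H k.+1 kK).
  by move=> [H0 H] [_|k kK] //=; rewrite /X iterSr; exact: H.
exists (distribution U Wf); split; last first.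
  move=> z /andP[z0 z1].
  have q0 : (0 <= \int[q]_k (z ^+ k)%:E)%E.
    by apply: integral_ge0 => k _; rewrite lee_fin exprn_ge0.
  have qE : (fine (\int[q]_k (z ^+ k)%:E))%:E = (\int[q]_k (z ^+ k)%:E)%E.
    rewrite fineK// ge0_fin_numE//.
    apply: (@le_lt_trans _ _ (\int[q]_k (cst 1 k))%E); last first.
      rewrite integral_cst// mul1e.
      by apply: (@le_lt_trans _ _ 1%E); [exact: probability_le1|exact: ltry].
    apply: ge0_le_integral => //.
    - by move=> k _; rewrite lee_fin exprn_ge0.
    - by move=> k _; rewrite lee_fin exprn_ile1.
  set s := fine _ in qE *.
  have s0 : 0 <= s by rewrite fine_ge0.
  have mzS l : measurable_fun setT (fun u => (z ^+ S l u)%:E).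
    exact: (measurableT_comp (f := fun j : nat => (z ^+ j)%:E)).
  (* Each peeled digit contributes one factor [s], the generating function of [q] at [z]. *)
  have SE l : (\int[U]_u (z ^+ S l u)%:E = (s ^+ l)%:E)%E.
    elim: l => [|l ih].
      rewrite (eq_integral (cst 1%E)); last by move=> u _; rewrite /S big_ord0.
      by rewrite integral_cst// mul1e; exact: probability_setT.
    under eq_integral do rewrite SS.
    rewrite (digit_integral (F := fun k u => (z ^+ (k + S l u))%:E) mD mT DT); last 2 first.
    - by move=> k; exact: (measurableT_comp (f := fun j : nat => (z ^+ (k + j))%:E)).
    - by move=> k u; rewrite lee_fin exprn_ge0.
    under eq_integral => k _.
      under eq_integral do rewrite exprD EFinM.
      rewrite ge0_integralZl//; last 2 first.
      - by move=> u _; rewrite lee_fin exprn_ge0.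
      - by rewrite lee_fin exprn_ge0.
      rewrite ih muleC; over.
    rewrite ge0_integralZl//; last 2 first.
    - by move=> u _; rewrite lee_fin exprn_ge0.
    - by rewrite lee_fin exprn_ge0.
    by rewrite -qE exprSr EFinM.
  rewrite (ge0_integral_distribution Wf)//; last first.
    by move=> k; rewrite lee_fin exprn_ge0.
  (* Integrating out the number of terms first leaves the Poisson generating function at [s]. *)
  rewrite /= (digit_integral (F := fun k u => (z ^+ S k u)%:E) mL mT0 LT0)//; last first.
    by move=> k u; rewrite lee_fin exprn_ge0.
  under eq_integral do rewrite SE.
  exact: pgf_poisson.
exists _, _, U, Lf, xif; split.
- by move=> A; rewrite /distribution /pushforward LU.
- move=> k A mA.
  change (U (T0 @^-1` (X k @^-1` (natR R @^-1` A))) = q (natR R @^-1` A)).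
  by rewrite T0U ?XU//; exact: pre.
- move=> K A B mB.
  pose C k : set nat := natR R @^-1` B k.
  have -> : \bigcap_(k < K) (xif k @^-1` B k) = T0 @^-1` (\bigcap_(k < K) (X k @^-1` C k)).
    by apply/seteqP; split.
  transitivity (poisson_prob lam 0 A * U (\bigcap_(k < K) (X k @^-1` C k)))%E.
    exact: LT0.
  rewrite capU -LU; congr (_ * _)%E; apply: eq_bigr => k _.
  by rewrite -(XU k) -T0U//; exact: pre.
- move=> A mA.
  change (U (W @^-1` (natR R @^-1` A)) =
    U [set u | A (\sum_(k < L u) (X k (T0 u))%:R)]).
  by congr (U _); apply/seteqP; split => u; rewrite /= /natR /W /S natr_sum.
Qed.

End compound.

(** * Continuity theorem for generating functions *)

Section nat_laws.
Context {R : realType}.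
Implicit Types (p : probability nat R) (f g : nat -> R).

Definition nat_bounded f := exists M : R, forall k, `|f k| <= M.

Lemma nat_boundedD f g : nat_bounded f -> nat_bounded g ->
  nat_bounded (fun k => f k + g k).
Proof.
move=> [M fM] [N gN]; exists (M + N) => k.
by rewrite (le_trans (ler_normD _ _))// lerD.
Qed.

Lemma nat_boundedZ (c : R) f : nat_bounded f -> nat_bounded (fun k => c * f k).
Proof. by move=> [M fM]; exists (`|c| * M) => k; rewrite normrM ler_wpM2l. Qed.

Lemma nat_bounded_integrable p f :
  nat_bounded f -> p.-integrable setT (EFin \o f).
Proof.
by move=> [M fM]; exact: bounded_integrable_prob fM.
Qed.

Lemma nat_boundedN f : nat_bounded f -> nat_bounded (fun k => - f k).
Proof. by move=> [M fM]; exists M => k; rewrite normrN. Qed.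

Lemma nat_RintegralD p f g : nat_bounded f -> nat_bounded g ->
  (\int[p]_k (f k + g k))%R = (\int[p]_k f k)%R + (\int[p]_k g k)%R.
Proof. by move=> bf bg; rewrite RintegralD//; exact: nat_bounded_integrable. Qed.

Lemma nat_RintegralZ p (c : R) f : nat_bounded f ->
  (\int[p]_k (c * f k))%R = c * (\int[p]_k f k)%R.
Proof. by move=> bf; rewrite RintegralZl//; exact: nat_bounded_integrable. Qed.

Lemma nat_Rintegral1 p : (\int[p]_k (1 : R))%R = 1.
Proof.
rewrite Rintegral_cst// mul1r -[RHS]/(fine 1%E); congr fine.
exact: probability_setT.
Qed.

Lemma nat_Rintegral_dist p f g (e : R) : nat_bounded f -> nat_bounded g ->
  (forall k, `|f k - g k| <= e) ->
  `|(\int[p]_k f k)%R - (\int[p]_k g k)%R| <= e.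
Proof.
move=> bf bg fge.
rewrite -RintegralB//; [|exact: nat_bounded_integrable..].
have bfg : nat_bounded (fun k => f k - g k) by exists e.
apply: (le_trans (le_normr_Rintegral measurableT (nat_bounded_integrable p bfg))).
rewrite -[leRHS]mulr1 -(nat_Rintegral1 p) -RintegralZl//; last first.
  by apply: nat_bounded_integrable; exists 1 => k; rewrite normr1.
apply: le_Rintegral => //.
- by apply: nat_bounded_integrable; exists e => k; rewrite normr_id.
- by apply: nat_bounded_integrable; exists `|e| => k; rewrite mulr1.
- by move=> k _; rewrite mulr1.
Qed.

Variables (p_ : nat -> probability nat R) (p : probability nat R).

Let good f := (\int[p_ n]_k f k)%R @[n --> \oo] --> (\int[p]_k f k)%R.

Let goodD f g : nat_bounded f -> nat_bounded g -> good f -> good g ->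
  good (fun k => f k + g k).
Proof.
move=> bf bg gf gg; rewrite /good nat_RintegralD//.
under eq_fun do rewrite nat_RintegralD//.
exact: cvgD.
Qed.

Let goodZ (c : R) f : nat_bounded f -> good f -> good (fun k => c * f k).
Proof.
move=> bf gf; rewrite /good nat_RintegralZ//.
under eq_fun do rewrite nat_RintegralZ//.
exact: cvgMr.
Qed.

(** Integration against a probability is 1-Lipschitz for the sup norm, hence three errors of
    [e / 3]. *)
Let good_unif f : nat_bounded f ->
  (forall e : R, 0 < e -> exists g,
    [/\ nat_bounded g, good g & forall k, `|f k - g k| <= e]) -> good f.
Proof.
move=> bf fg; apply/cvgrPdist_le => e e0.
have [g [bg /cvgrPdist_le gg fge]] := fg _ (divr_gt0 e0 (ltr0n _ 3)).
near=> n.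
have := nat_Rintegral_dist p bf bg fge.
have := nat_Rintegral_dist (p_ n) bf bg fge.
have : `|(\int[p]_k g k)%R - (\int[p_ n]_k g k)%R| <= e / 3.
  by near: n; apply: gg; rewrite divr_gt0.
rewrite !ler_norml => /andP[? ?] /andP[? ?] /andP[? ?].
by apply/andP; split; lra.
Unshelve. all: by end_near.
Qed.

Let dlt (k j : nat) : R := (j == k)%:R.

Let bdlt k : nat_bounded (dlt k).
Proof. by exists 1 => j; rewrite /dlt; case: eqP => _; rewrite ?normr1 ?normr0. Qed.

Let good_comb (c : nat -> R) K : (forall l, (l < K)%N -> good (dlt l)) ->
  nat_bounded (fun j => \sum_(l < K) c l * dlt l j) /\
  good (fun j => \sum_(l < K) c l * dlt l j).
Proof.
elim: K => [|K ih] gK.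
  have -> : (fun j => \sum_(l < 0) c l * dlt l j) = (fun j => 0 * dlt 0 j).
    by apply/funext => j; rewrite big_ord0 mul0r.
  split; first exact: nat_boundedZ.
  rewrite /good nat_RintegralZ//; under eq_fun do rewrite nat_RintegralZ//.
  by rewrite mul0r; under eq_fun do rewrite mul0r; exact: cvg_cst.
have [|bK gK'] := ih; first by move=> l lK; apply: gK; rewrite ltnW.
have -> : (fun j => \sum_(l < K.+1) c l * dlt l j) =
    (fun j => \sum_(l < K) c l * dlt l j + c K * dlt K j).
  by apply/funext => j; rewrite big_ord_recr.
have bc := nat_boundedZ (c K) (bdlt K).
split; first exact: nat_boundedD.
by apply: goodD => //; apply: goodZ => //; exact: gK.
Qed.

Let sum_dlt (c : nat -> R) K j :
  \sum_(l < K) c l * dlt l j = if (j < K)%N then c j else 0.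
Proof.
case: ifPn => jK.
  rewrite (bigD1 (Ordinal jK))//= /dlt eqxx mulr1 big1 ?addr0// => l lj.
  rewrite (_ : (j == l) = false) ?mulr0//; apply: contraNF lj => /eqP jl.
  by apply/eqP/val_inj; rewrite /= jl.
rewrite big1// => l _; rewrite /dlt (_ : (j == l) = false) ?mulr0//.
by apply: contraNF jK => /eqP ->.
Qed.

Hypothesis pgf_cvg : forall z : R, 0 < z < 1 ->
  (\int[p_ n]_k (z ^+ k)%:E)%E @[n --> \oo] --> (\int[p]_k (z ^+ k)%:E)%E.

(* Uniformly in [j], [z^-k (z^j - sum_(l < k) z^l [j = l])] is within [z] of
   the indicator of [j = k]. *)
Let good_dlt k : good (dlt k).
Proof.
elim/ltn_ind: k => k ih; apply: good_unif => // e e0.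
(* [z <= e] bounds the error; the cap [1 / 2] keeps [z] where [pgf_cvg] applies. *)
pose z := Num.min e 2^-1.
have z0 : 0 < z by rewrite lt_min e0 invr_gt0 ltr0n.
have z1 : z < 1 by rewrite gt_min invf_lt1 ?ltr1n ?orbT.
have ze : z <= e by rewrite ge_min lexx.
have bz : nat_bounded (fun j => z ^+ j).
  exists 1 => j; rewrite ger0_norm ?exprn_ge0 ?exprn_ile1// ltW//.
have gz : good (fun j => z ^+ j).
  have := pgf_cvg (introT andP (conj z0 z1)).
  rewrite -(fineK (integrable_fin_num measurableT (nat_bounded_integrable p bz))).
  exact: fine_cvg.
have [bc gc] := good_comb (fun l => z ^+ l) ih.
exists (fun j => z ^- k * (z ^+ j + (-1) * \sum_(l < k) z ^+ l * dlt l j)).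
have bmc := nat_boundedZ (-1) bc.
have bs := nat_boundedD bz bmc.
split; first exact: nat_boundedZ.
  by apply: goodZ => //; apply: goodD => //; exact: goodZ.
move=> j; rewrite sum_dlt /dlt mulN1r.
have zk : z ^- k * z ^+ k = 1 by rewrite mulVf// expf_neq0// gt_eqF.
have [jk|jk|->] := ltngtP j k.
- by rewrite subrr mulr0 subr0 normr0 ltW.
(* For [j > k] the value is [z ^+ (j - k)], hence at most [z]. *)
- rewrite subr0 sub0r normrN ger0_norm; last first.
    by rewrite mulr_ge0 ?invr_ge0 ?exprn_ge0// ltW.
  rewrite -(subnK (ltnW jk)) exprD [z ^+ _ * _]mulrC mulrA zk mul1r.
  rewrite (le_trans _ ze)//; move: jk; rewrite -subn_gt0.
  case: (j - k)%N => // l _; rewrite exprS ler_piMr ?(ltW z0)//.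
  by rewrite exprn_ile1 ?ltW.
- by rewrite subr0 zk subrr normr0 ltW.
Qed.

(** Point masses converge by [good_dlt], hence so do integrals of finitely supported functions.
    Applied to the indicator of [I_K], this also transfers the small tail of [p] to [p_ n], which
    controls the rest of [f]. *)
Theorem pgf_continuity f : nat_bounded f ->
  (\int[p_ n]_k (f k)%:E)%E @[n --> \oo] --> (\int[p]_k (f k)%:E)%E.
Proof.
move=> bf; have [M fM] := bf.
have M0 : 0 <= M by apply: le_trans (fM 0%N).
suff gf : good f.
  have fE (q : probability nat R) : (\int[q]_k (f k)%:E)%E = ((\int[q]_k f k)%R)%:E.
    rewrite /Rintegral fineK//; apply: integrable_fin_num => //.
    exact: nat_bounded_integrable.
  rewrite fE; under eq_fun do rewrite fE.
  by apply: cvg_EFin => //; near=> n.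
apply/cvgrPdist_le => e e0.
(* The [+ 1] covers [M = 0]. The budget is [e / 4] for the tail of [p], [e / 2] for that of [p_ n],
   and [e / 4] for the truncated function. *)
have e'0 : 0 < e / (4 * (M + 1)) by rewrite divr_gt0// mulr_gt0// ltr_wpDl.
have [K pK] : exists K, 1 - e / (4 * (M + 1)) <= fine (p `I_K).
  near \oo => K; exists K; near: K.
  apply: (cvgr_ge _ (cvg_prob_II p)); lra.
pose one j : R := if (j < K)%N then 1 else 0.
pose fK j : R := if (j < K)%N then f j else 0.
have [bone gone] : nat_bounded one /\ good one.
  have -> : one = fun j => \sum_(l < K) (fun=> 1) l * dlt l j.
    by apply/funext => j; rewrite (sum_dlt (fun=> 1)).
  exact: (good_comb (K := K) (fun=> 1) (fun l _ => @good_dlt l)).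
have [bfK gfK] : nat_bounded fK /\ good fK.
  have -> : fK = fun j => \sum_(l < K) f l * dlt l j.
    by apply/funext => j; rewrite sum_dlt.
  exact: (good_comb (K := K) f (fun l _ => @good_dlt l)).
have b1 : nat_bounded (fun=> 1 : R) by exists 1 => k; rewrite normr1.
have oneE (q : probability nat R) : (\int[q]_k one k)%R = fine (q `I_K).
  rewrite /Rintegral; congr fine.
  transitivity (q (`I_K `&` setT)); last by rewrite setIT.
  rewrite -(integral_indic q measurableT (A := `I_K))//.
  apply: eq_integral => k _; rewrite /one indicE.
  by case: ifPn => kK; [rewrite mem_set|rewrite memNset//; apply/negP].
have tail (q : probability nat R) : `|(\int[q]_k f k)%R - (\int[q]_k fK k)%R| <=
    M * (1 - (\int[q]_k one k)%R).
  rewrite -RintegralB//; [|exact: nat_bounded_integrable..].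
  have bs : nat_bounded (fun k => f k - fK k).
    by apply: nat_boundedD => //; exact: nat_boundedN.
  apply: (le_trans (le_normr_Rintegral measurableT (nat_bounded_integrable q bs))).
  rewrite -(nat_Rintegral1 q) -RintegralB//; [|exact: nat_bounded_integrable..].
  have bo : nat_bounded (fun k => 1 - one k).
    by apply: nat_boundedD => //; exact: nat_boundedN.
  rewrite -nat_RintegralZ//.
  apply: le_Rintegral => //.
  - by apply: nat_bounded_integrable; case: bs => N bN; exists N => k; rewrite normr_id.
  - by apply: nat_bounded_integrable; exact: nat_boundedZ.
  - move=> k _; rewrite /fK /one; case: ifPn => _.
      by rewrite !subrr normr0 mulr0.
    by rewrite !subr0 mulr1.
near=> n.
have n1 : `|(\int[p]_k one k)%R - (\int[p_ n]_k one k)%R| <= e / (4 * (M + 1)).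
  by near: n; move/cvgrPdist_le : gone; apply.
have n2 : `|(\int[p]_k fK k)%R - (\int[p_ n]_k fK k)%R| <= e / 4.
  by near: n; move/cvgrPdist_le : gfK; apply; rewrite divr_gt0.
have tp := tail p; have tn := tail (p_ n).
set a := (\int[p]_k one k)%R in n1 tp.
set b := (\int[p_ n]_k one k)%R in n1 tn.
have a1 : 1 - a <= e / (4 * (M + 1)) by rewrite /a oneE; lra.
have Me : M * (e / (4 * (M + 1))) <= e / 4.
  have -> : M * (e / (4 * (M + 1))) = e / 4 * (M / (M + 1)).
    by field; rewrite gt_eqF// ltr_wpDl.
  rewrite ler_piMr ?divr_ge0 ?(ltW e0)// ler_pdivrMr ?mul1r ?ltr_wpDl// lerDl//.
have b1' : 1 - b <= e / (4 * (M + 1)) + e / (4 * (M + 1)).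
  by move: n1; rewrite ler_norml => /andP[_]; lra.
have Ma : M * (1 - a) <= e / 4 by rewrite (le_trans _ Me)// ler_wpM2l.
have Mb : M * (1 - b) <= e / 2.
  have := ler_wpM2l M0 b1'; rewrite mulrDr; lra.
move: tp tn n2; rewrite !ler_norml => /andP[? ?] /andP[? ?] /andP[? ?].
by apply/andP; split; lra.
Unshelve. all: by end_near.
Qed.

End nat_laws.

(** * Expectations over the random bipartite graph *)

Section graph_expectation.
Context {R : realType} {n m : nat} (G : probability (bigraph n m) R).
Implicit Types (f g : bigraph n m -> R) (h : bigraph n m).

(** The expectation over [G] as a finite sum, so that exchanging sums needs no integrability. *)
Definition graph_mean f : R := \sum_(h : bigraph n m) fine (G [set h]) * f h.

Lemma graph_meanE f : (\int[G]_h (f h)%:E = (graph_mean f)%:E)%E.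
Proof.
have mA (A : set (bigraph n m)) : measurable A by [].
have ind (a : bigraph n m) : G.-integrable setT (EFin \o \1_[set a]).
  apply: (bounded_integrable_prob G (M := 1)) => // h.
  by rewrite indicE; case: (_ \in _); rewrite ?normr1 ?normr0.
transitivity (\int[G]_h (\sum_(a : bigraph n m) (f a)%:E * (\1_[set a] h)%:E))%E.
  apply: eq_integral => h _; rewrite (bigD1 h)//= indicE mem_set//= mule1.
  rewrite big1 ?adde0// => a ah; rewrite indicE memNset ?mule0//= => ha.
  by rewrite ha eqxx in ah.
rewrite integral_sum//; last first.
  by move=> a; apply: integrableZl; [exact: mA|exact: ind].
rewrite /graph_mean -sumEFin; apply: eq_bigr => a _.
rewrite (integralZl (mA setT) (ind a)) integral_indic// setIT EFinM muleC fineK//.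
exact: fin_num_measure.
Qed.

Lemma graph_mean_sum (I : finType) (P : pred I) (F : I -> bigraph n m -> R) :
  graph_mean (fun h => \sum_(i | P i) F i h) = \sum_(i | P i) graph_mean (F i).
Proof.
by rewrite /graph_mean exchange_big; apply: eq_bigr => h _; rewrite mulr_sumr.
Qed.

Lemma graph_meanD f g :
  graph_mean (fun h => f h + g h) = graph_mean f + graph_mean g.
Proof. by rewrite -big_split; apply: eq_bigr => h _; rewrite mulrDr. Qed.

Lemma graph_meanZ c f : graph_mean (fun h => c * f h) = c * graph_mean f.
Proof. by rewrite mulr_sumr; apply: eq_bigr => h _; rewrite mulrCA. Qed.

Lemma graph_mean_dist f g b : (forall h, `|f h - g h| <= b h) ->
  `|graph_mean f - graph_mean g| <= graph_mean b.
Proof.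
move=> fgb; rewrite /graph_mean -sumrB (le_trans (ler_norm_sum _ _ _))//.
apply: ler_sum => h _; rewrite -mulrBr normrM ger0_norm ?fine_ge0//.
by rewrite ler_wpM2l// fine_ge0.
Qed.

Variable p : 'I_n -> 'I_m -> R.
Hypothesis Gp : independent_edges p G.

Lemma graph_mean_subset (J : {set 'I_n * 'I_m}) :
  graph_mean (fun h => (J \subset h)%:R) = \prod_(e in J) p e.1 e.2.
Proof.
have mA (A : set (bigraph n m)) : measurable A by [].
apply: EFin_inj; rewrite -graph_meanE.
transitivity (G [set h : bigraph n m | J \subset h]).
  rewrite -[X in G X]setIT -integral_indic//; apply: eq_integral => h _.
  by rewrite indicE; congr ((nat_of_bool _)%:R)%:E; apply/idP/idP; rewrite inE.
rewrite Gp.2 -prodEFin; apply: eq_bigr => -[i u] _; exact: Gp.1.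
Qed.

Lemma graph_mean_prod (phi : 'I_n * 'I_m -> bool -> R) :
  graph_mean (fun h => \prod_e phi e (e \in h)) =
  \prod_e (p e.1 e.2 * phi e true + (1 - p e.1 e.2) * phi e false).
Proof.
transitivity (graph_mean (fun h => \sum_(J : {set 'I_n * 'I_m})
    (\prod_e (if e \in J then phi e true - phi e false else phi e false)) *
    (J \subset h)%:R)).
  apply: eq_bigr => h _; congr (_ * _).
  transitivity (\prod_e ((phi e true - phi e false) * (e \in h)%:R + phi e false)).
    apply: eq_bigr => e _; case: (e \in h); rewrite ?mulr1 ?mulr0 ?add0r//.
    by rewrite subrK.
  rewrite bigA_distr; apply: eq_bigr => J _.
  case: (boolP (J \subset h)) => [Jh|].
    rewrite mulr1; apply: eq_bigr => e _; case: ifPn => // eJ.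
    by rewrite (fintype.subsetP Jh _ eJ) mulr1.
  move=> /fintype.subsetPn[e eJ eh]; rewrite mulr0; apply/eqP/prodf_eq0; exists e => //.
  by rewrite eJ (negbTE eh) mulr0.
rewrite graph_mean_sum.
transitivity (\sum_(J : {set 'I_n * 'I_m}) \prod_e
   (if e \in J then p e.1 e.2 * (phi e true - phi e false) else phi e false)).
  apply: eq_bigr => J _; rewrite graph_meanZ graph_mean_subset.
  rewrite [X in _ * X]big_mkcond -big_split/=; apply: eq_bigr => e _.
  by case: ifPn => _; rewrite ?mulr1// mulrC.
transitivity (\prod_(e : 'I_n * 'I_m)
    (p e.1 e.2 * (phi e true - phi e false) + phi e false)).
  by rewrite bigA_distr.
by apply: eq_bigr => e _; ring.
Qed.

Variables (i : 'I_n) (z : R).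
Hypothesis z01 : 0 <= z <= 1.

(* [z] to the number of pairs [(j, u)], [j <> i], such that [u] is a common
   neighbour of [i] and [j]. *)
Let zS h : R := \prod_u (if (i, u) \in h then
  \prod_(j | j != i) (if (j, u) \in h then z else 1) else 1).

Lemma graph_mean_zS : graph_mean zS =
  \prod_u (1 - p i u * (1 - \prod_(j | j != i) (1 - (1 - z) * p j u))).
Proof.
(* Row [i] of [phi U] is the indicator that the neighbourhood of [i] is exactly [U]; the other rows
   give [z] for each edge into [U]. *)
pose phi (U : {set 'I_m}) (e : 'I_n * 'I_m) (b : bool) : R :=
  if e.1 == i then (if e.2 \in U then b%:R else (~~ b)%:R)
  else if (e.2 \in U) && b then z else 1.
transitivity (graph_mean (fun h => \sum_(U : {set 'I_m}) \prod_e phi U e (e \in h))).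
  apply: eq_bigr => h _; congr (_ * _); rewrite /zS.
  transitivity (\prod_u (((i, u) \in h)%:R *
      \prod_(j | j != i) (if (j, u) \in h then z else 1) +
      ((i, u) \notin h)%:R)).
    by apply: eq_bigr => u _; case: ifPn => _; rewrite ?mul1r ?addr0 ?mul0r ?add0r.
  rewrite bigA_distr; apply: eq_bigr => U _.
  transitivity (\prod_u \prod_j phi U (j, u) ((j, u) \in h)).
    apply: eq_bigr => u _; rewrite [RHS](bigD1 i)//= /phi/= eqxx.
    case: ifPn => uU.
      congr (_ * _); apply: eq_bigr => j ji; rewrite (negbTE ji).
      by case: ifP.
    by rewrite big1 ?mulr1// => j ji; rewrite (negbTE ji).
  by rewrite exchange_big pair_big/=; apply: eq_bigr => -[].
rewrite graph_mean_sum.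
rewrite (eq_bigr _ (fun U _ => graph_mean_prod (phi U))).
transitivity (\prod_u (p i u * \prod_(j | j != i) (1 - (1 - z) * p j u) +
   (1 - p i u))); last by apply: eq_bigr => u _; ring.
rewrite bigA_distr; apply: eq_bigr => U _.
transitivity (\prod_u \prod_j (p j u * phi U (j, u) true +
    (1 - p j u) * phi U (j, u) false)).
  by rewrite exchange_big pair_big/=; apply: eq_bigr => -[].
apply: eq_bigr => u _; rewrite (bigD1 i)//= /phi/= eqxx; case: ifPn => uU.
  rewrite mulr1 mulr0 addr0; congr (_ * _); apply: eq_bigr => j ji.
  by rewrite (negbTE ji)/=; ring.
rewrite mulr0 mulr1 add0r big1 ?mulr1// => j ji.
by rewrite (negbTE ji)/=; ring.
Qed.

Lemma prod_if_itv01 (J : finType) (P : pred J) (b : pred J) :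
  0 <= \prod_(j | P j) (if b j then z else 1) <= 1.
Proof.
case/andP: z01 => z0 z1; apply/andP; split.
  by apply: prodr_ge0 => j _; case: ifP.
by apply: prodr_ile1 => j _; case: ifP => _; rewrite ?z0 ?z1 ?ler01 ?lexx.
Qed.

(** Both quantities lie in the unit interval, so their distance is at most 1, and some summand on
    the right equals 1 whenever they differ: if [i] has no [big] neighbour and shares at most one
    neighbour with each [j], then counting pairs counts vertices. *)
Lemma zdegree_dist (big : pred 'I_m) h :
  `|z ^+ #|affiliation_adj h i| - zS h| <=
  \sum_(u | big u) ((i, u) \in h)%:R +
  \sum_(j | j != i) \sum_(u | ~~ big u) \sum_(v | ~~ big v && (v != u))
    [&& (i, u) \in h, (i, v) \in h, (j, u) \in h & (j, v) \in h]%:R.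
Proof.
case/andP: (z01) => z0 z1.
have A0 : 0 <= \sum_(u | big u) ((i, u) \in h)%:R :> R by apply: sumr_ge0.
have B0 : 0 <= \sum_(j | j != i) \sum_(u | ~~ big u) \sum_(v | ~~ big v && (v != u))
    [&& (i, u) \in h, (i, v) \in h, (j, u) \in h & (j, v) \in h]%:R :> R.
  by apply: sumr_ge0 => j _; apply: sumr_ge0 => u _; apply: sumr_ge0.
have zdE : z ^+ #|affiliation_adj h i| =
    \prod_(j | j != i) (if [exists u, ((i, u) \in h) && ((j, u) \in h)] then z else 1).
  rewrite -prodr_const big_mkcond [RHS]big_mkcond/=; apply: eq_bigr => j _.
  by rewrite unfold_in /affiliation_adj [j == i]eq_sym; case: (i == j).
have zSE : zS h =
    \prod_(j | j != i) \prod_u (if ((i, u) \in h) && ((j, u) \in h) then z else 1).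
  rewrite exchange_big; apply: eq_bigr => u _; case: ifPn => // _.
  by rewrite big1.
have bnd : `|z ^+ #|affiliation_adj h i| - zS h| <= 1.
  have : 0 <= z ^+ #|affiliation_adj h i| <= 1 by rewrite exprn_ge0// exprn_ile1.
  have : 0 <= zS h <= 1.
    rewrite zSE; apply/andP; split.
      by apply: prodr_ge0 => j _; apply: prodr_ge0 => u _; case: ifP.
    by apply: prodr_ile1 => j _; exact: prod_if_itv01.
  by rewrite ler_norml => /andP[? ?] /andP[? ?]; apply/andP; split; lra.
have [/existsP[u /andP[bu iu]]|noA] := boolP [exists u, big u && ((i, u) \in h)].
  apply: (le_trans bnd); rewrite -[leLHS]addr0; apply: lerD => //.
  by rewrite (bigD1 u)//= iu lerDl sumr_ge0.
have nbig u : (i, u) \in h -> ~~ big u.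
  move=> iu; apply: contraNN noA => bu; apply/existsP; exists u; exact/andP.
have [uv|] := pselect (exists j u v, [/\ j != i, v != u &
    [&& (i, u) \in h, (i, v) \in h, (j, u) \in h & (j, v) \in h]]).
  have [j [u [v [ji vu /and4P[iu iv ju jv]]]]] := uv.
  apply: (le_trans bnd); rewrite -[leLHS]add0r; apply: lerD => //.
  rewrite (bigD1 j)//= (bigD1 u) ?nbig//= (bigD1 v) ?nbig ?vu//=.
  rewrite iu iv ju jv/= -!addrA lerDl !addr_ge0// ?sumr_ge0// => *.
    by rewrite sumr_ge0.
  by rewrite sumr_ge0// => *; rewrite sumr_ge0.
move=> nuv; rewrite (_ : _ - _ = 0) ?normr0 ?addr_ge0//.
apply/eqP; rewrite subr_eq0; apply/eqP; rewrite zdE zSE.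
apply: eq_bigr => j ji; case: ifPn => [/existsP[u /andP[iu ju]]|/existsPn nu].
  rewrite (bigD1 u)//= iu ju/= big1 ?mulr1// => v vu.
  case: ifPn => // /andP[iv jv]; exfalso; apply: nuv; exists j, u, v.
  by rewrite iu iv ju jv.
by rewrite big1// => u _; rewrite (negbTE (nu u)).
Qed.

Lemma graph_mean_zdegree (big : pred 'I_m) :
  `|graph_mean (fun h => z ^+ #|affiliation_adj h i|) -
    \prod_u (1 - p i u * (1 - \prod_(j | j != i) (1 - (1 - z) * p j u)))| <=
  \sum_(u | big u) p i u +
  \sum_(j | j != i) \sum_(u | ~~ big u) \sum_(v | ~~ big v && (v != u))
    p i u * p i v * (p j u * p j v).
Proof.
rewrite -graph_mean_zS.
apply: (le_trans (graph_mean_dist (zdegree_dist big))).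
rewrite graph_meanD !graph_mean_sum; apply: lerD.
  apply: ler_sum => u _; rewrite le_eqVlt; apply/orP; left; apply/eqP.
  transitivity (graph_mean (fun h => ([set (i, u)]%SET \subset h)%:R)).
    by apply: eq_bigr => h _; rewrite finset.sub1set.
  by rewrite graph_mean_subset big_set1.
apply: ler_sum => j ji; rewrite graph_mean_sum; apply: ler_sum => u _.
rewrite graph_mean_sum; apply: ler_sum => v /andP[_ vu].
rewrite le_eqVlt; apply/orP; left; apply/eqP.
transitivity (graph_mean (fun h =>
    (((i, u) |: ((i, v) |: ((j, u) |: [set (j, v)])))%SET \subset h)%:R)).
  by apply: eq_bigr => h _; rewrite !finset.subUset !finset.sub1set.
(* The four edges are distinct because [i != j] and [u != v], so their probabilities multiply. *)
rewrite graph_mean_subset !big_setU1 ?big_set1/= ?mulrA//.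
- by rewrite inE xpair_eqE [u == v]eq_sym (negbTE vu) andbF.
- by rewrite !inE !xpair_eqE ![i == j]eq_sym (negbTE ji).
- by rewrite !inE !xpair_eqE ![i == j]eq_sym (negbTE ji) ![u == v]eq_sym (negbTE vu) !andbF.
Qed.

End graph_expectation.

(** * Estimates for a fixed graph size *)

Section real_bounds.
Context {R : realType}.
Implicit Types a b q mu : R.

Lemma prod_dist (I : finType) (P : pred I) (a b : I -> R) :
  (forall i, P i -> 0 <= a i <= 1) -> (forall i, P i -> 0 <= b i <= 1) ->
  `|\prod_(i | P i) a i - \prod_(i | P i) b i| <= \sum_(i | P i) `|a i - b i|.
Proof.
move=> a01 b01.
(* The induction carries the bounds on both partial products, which the telescoping step uses. *)
suff : [/\ 0 <= \prod_(i | P i) a i <= 1, 0 <= \prod_(i | P i) b i <= 1 &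
    `|\prod_(i | P i) a i - \prod_(i | P i) b i| <= \sum_(i | P i) `|a i - b i|].
  by case.
elim/big_rec3 : _ => [|i S B A Pi [/andP[A0 A1] /andP[B0 B1] AB]].
  by rewrite subrr normr0 ler01 lexx.
have /andP[ai0 ai1] := a01 i Pi; have /andP[bi0 bi1] := b01 i Pi.
split; rewrite ?mulr_ge0 ?mulr_ile1//.
have -> : a i * A - b i * B = (a i - b i) * A + b i * (A - B) by ring.
rewrite (le_trans (ler_normD _ _))// !normrM lerD//.
  by rewrite ler_piMr// ger0_norm.
by rewrite [`|b i|]ger0_norm// (le_trans _ AB)// ler_piMl.
Qed.

(** The upper bound comes from [expR (- q) * (1 + q) <= 1]. *)
Lemma expRN_dist q : 0 <= q -> `|expR (- q) - (1 - q)| <= q ^+ 2.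
Proof.
move=> q0; have := expR_ge1Dx (- q) => e1.
rewrite ger0_norm ?subr_ge0//.
have e2 : expR (- q) * (1 + q) <= 1.
  rewrite -[leRHS](expRxMexpNx_1 q) mulrC ler_wpM2r ?expR_ge0//.
  exact: expR_ge1Dx.
have e3 : expR (- q) <= 1 by rewrite expR_le1 oppr_le0.
rewrite expr2; nra.
Qed.

Lemma expRN_lip a b : 0 <= a -> 0 <= b -> `|expR (- a) - expR (- b)| <= `|a - b|.
Proof.
wlog ab : a b / a <= b => [hw a0 b0|a0 b0].
  case/orP: (le_total a b) => ab; first exact: hw.
  by rewrite distrC [leRHS]distrC; exact: hw.
rewrite ger0_norm ?subr_ge0 ?ler_expR ?lerN2// ler0_norm ?subr_le0// opprB.
have -> : - b = - a + (a - b) by ring.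
rewrite expRD; have := expR_ge1Dx (a - b).
have : expR (- a) <= 1 by rewrite expR_le1 oppr_le0.
have := expR_ge0 (- a); nra.
Qed.

(** With [a = y_j x_u] this linearizes the edge probability. The quadratic error comes from the gap
    being exactly [a / mu] times [a / (a + mu)]. *)
Lemma frac_bounds a mu : 0 <= a -> 0 < mu ->
  [/\ 0 <= a / (a + mu), a / (a + mu) <= 1, a / (a + mu) <= a / mu &
      `|a / (a + mu) - a / mu| <= (a / mu) ^+ 2].
Proof.
move=> a0 mu0; have am : 0 < a + mu by rewrite ltr_wpDl.
have h : a / (a + mu) <= a / mu.
  by rewrite ler_wpM2l// lef_pV2 ?posrE// lerDr.
split => //.
- by rewrite divr_ge0// ltW.
- by rewrite ler_pdivrMr// mul1r lerDl ltW.
- rewrite ler0_norm ?subr_le0// opprB.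
  have -> : a / mu - a / (a + mu) = a / mu * (a / (a + mu)).
    by field; rewrite !gt_eqF.
  by rewrite expr2 ler_wpM2l// divr_ge0// ltW.
Qed.

End real_bounds.

Section pgf_estimate.
Context {R : realType} (x y : nat -> R) (n m : nat) (i : 'I_n) (mu w c K : R).
Hypotheses (x_ge0 : forall u, 0 <= x u) (y_ge0 : forall j, 0 <= y j).
Hypotheses (mu_gt0 : 0 < mu) (w01 : 0 <= w <= 1) (c_ge0 : 0 <= c) (K_ge0 : 0 <= K).

Local Notation p j u := (edge_prob y x mu (j : 'I_n) (u : 'I_m)).

Let SX := \sum_(u < m) x u / mu.
Let SX2 := \sum_(u < m) (x u / mu) ^+ 2.
Let SY := \sum_(j < n) y j / mu.
Let SY2 := \sum_(j < n) (y j / mu) ^+ 2.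
Let TX := \sum_(u < m | K < x u) x u / mu.

Lemma edge_prob_bounds (j : 'I_n) (u : 'I_m) :
  [/\ 0 <= p j u, p j u <= 1, p j u <= y j / mu * x u &
      `|p j u - y j / mu * x u| <= (y j / mu * x u) ^+ 2].
Proof.
have -> : y j / mu * x u = y j * x u / mu by rewrite mulrAC.
by apply: frac_bounds => //; exact: mulr_ge0.
Qed.

Let ym_ge0 j : 0 <= y j / mu. Proof. by rewrite divr_ge0// ltW. Qed.

(** [phi u] is the generating function at [1 - w] of the number of neighbours of [u] other than [i];
    [psi u] is its Poisson approximation, of mean [c * x u]. *)
Let phi (u : 'I_m) := \prod_(j < n | j != i) (1 - w * p j u).
Let psi (u : 'I_m) := expR (- (w * c * x u)).

Let wp01 j u : 0 <= w * p j u <= 1.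
Proof.
case/andP: w01 => w0 w1; have [p0 p1 _ _] := edge_prob_bounds j u.
by rewrite mulr_ge0// mulr_ile1.
Qed.

Let phi01 u : 0 <= phi u <= 1.
Proof.
apply/andP; split.
  by apply: prodr_ge0 => j _; have /andP[? ?] := wp01 j u; lra.
by apply: prodr_ile1 => j _; have /andP[? ?] := wp01 j u; lra.
Qed.

Let psi01 u : 0 <= psi u <= 1.
Proof.
case/andP: w01 => w0 w1.
by rewrite expR_ge0 expR_le1 oppr_le0 !mulr_ge0.
Qed.

Let SY2_ge0 : 0 <= SY2. Proof. by apply: sumr_ge0 => j _; exact: sqr_ge0. Qed.

(** The product is first replaced by the exponential of the same probabilities, then their sum by
    [w * c * x u]. Each step costs [K ^+ 2 * SY2]; the second also pays for [SY - c] and for the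
    term [j = i], present in [SY] but not in the product. *)
Let phi_psi (u : 'I_m) : x u <= K ->
  `|phi u - psi u| <= 2 * K ^+ 2 * SY2 + K * (`|SY - c| + y i / mu).
Proof.
move=> xK; case/andP: (w01) => w0 w1.
pose r j := w * p j u; pose t (j : 'I_n) := y j / mu * x u.
have rt j : [/\ 0 <= r j, r j <= t j & `|r j - w * t j| <= (t j) ^+ 2].
  have [p0 p1 p2 p3] := edge_prob_bounds j u.
  split; first by rewrite mulr_ge0.
    by rewrite (le_trans _ p2)// ler_piMl.
  by rewrite /r -mulrBr normrM ger0_norm// (le_trans _ p3)// ler_piMl.
have t2 (j : 'I_n) : (t j) ^+ 2 <= K ^+ 2 * (y j / mu) ^+ 2.
  rewrite /t exprMn mulrC ler_wpM2r ?sqr_ge0//.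
  by rewrite ler_pXn2r// nnegrE.
have st2 (P : pred 'I_n) : \sum_(j < n | P j) (t j) ^+ 2 <= K ^+ 2 * SY2.
  rewrite /SY2 mulr_sumr [leLHS]big_mkcond; apply: ler_sum => j _.
  by case: ifP => _ //; rewrite mulr_ge0 ?sqr_ge0 ?exprn_ge0.
have d1 : `|phi u - expR (- \sum_(j | j != i) r j)| <= K ^+ 2 * SY2.
  rewrite -sumrN expR_sum (le_trans (prod_dist _ _))//.
  - by move=> j _; have /andP[? ?] := wp01 j u; apply/andP; split; lra.
  - move=> j _; have [r0 _ _] := rt j.
    by rewrite expR_ge0 expR_le1 oppr_le0.
  - rewrite (le_trans _ (st2 (fun j => j != i)))//; apply: ler_sum => j _.
    have [r0 r1 _] := rt j.
    rewrite distrC (le_trans (expRN_dist r0))//.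
    by rewrite ler_pXn2r// nnegrE// (le_trans r0).
have d2 : `|\sum_(j | j != i) r j - w * c * x u| <=
    K ^+ 2 * SY2 + K * (`|SY - c| + y i / mu).
  have -> : \sum_(j | j != i) r j - w * c * x u =
      \sum_(j | j != i) (r j - w * t j) + w * x u * (SY - c - y i / mu).
    have -> : SY = y i / mu + \sum_(j | j != i) y j / mu.
      by rewrite /SY (bigD1 i).
    have st : \sum_(j | j != i) w * t j = w * ((\sum_(j | j != i) y j / mu) * x u).
      by rewrite mulr_suml mulr_sumr.
    by rewrite sumrB st; ring.
  rewrite (le_trans (ler_normD _ _))// lerD//.
    rewrite (le_trans (ler_norm_sum _ _ _))// (le_trans _ (st2 (fun j => j != i)))//.
    by apply: ler_sum => j _; have [_ _] := rt j.
  rewrite normrM ler_pM//.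
    by rewrite ger0_norm ?mulr_ge0// (le_trans _ xK)// ler_piMl.
  by rewrite (le_trans (ler_normB _ _))// lerD// ger0_norm.
have s0 : 0 <= \sum_(j | j != i) r j by apply: sumr_ge0 => j _; have [] := rt j.
have wc0 : 0 <= w * c * x u by rewrite !mulr_ge0.
have := le_trans (expRN_lip s0 wc0) d2 => d3.
have -> : phi u - psi u = (phi u - expR (- \sum_(j | j != i) r j)) +
   (expR (- \sum_(j | j != i) r j) - psi u) by ring.
by rewrite (le_trans (ler_normD _ _))//; lra.
Qed.

(** The errors, in order: linearizing [p i u] and the exponential of each column; columns with
    [x u > K], where [phi u] and [psi u] differ by at most 1; the remaining columns, by
    [phi_psi]. *)
Lemma pgf_estimate :
  `|\prod_(u < m) (1 - p i u * (1 - \prod_(j < n | j != i) (1 - w * p j u))) -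
    expR (- (y i / mu * \sum_(u < m) x u * (1 - expR (- (w * c * x u)))))| <=
  2 * y i ^+ 2 * SX2 + y i * TX +
    y i * SX * (2 * K ^+ 2 * SY2 + K * (`|SY - c| + y i / mu)).
Proof.
set E := 2 * K ^+ 2 * SY2 + _.
have E0 : 0 <= E.
  by rewrite addr_ge0 ?mulr_ge0 ?exprn_ge0 ?addr_ge0 ?ym_ge0.
pose a (u : 'I_m) := y i / mu * x u.
pose t u := a u * (1 - psi u).
have a0 u : 0 <= a u by rewrite mulr_ge0.
have t01 u : 0 <= t u <= a u.
  have /andP[p0 p1] := psi01 u.
  by rewrite mulr_ge0 ?subr_ge0//= ler_piMr// gerBl.
rewrite mulr_sumr -sumrN expR_sum.
apply: (le_trans (prod_dist _ _)).
- move=> u _; have [p0 p1 _ _] := edge_prob_bounds i u.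
  have /andP[f0 f1] := phi01 u; rewrite -/(phi u).
  have : 0 <= p i u * (1 - phi u) by rewrite mulr_ge0// subr_ge0.
  have : p i u * (1 - phi u) <= 1 by rewrite mulr_ile1// ?subr_ge0// gerBl.
  by move=> ? ?; apply/andP; split; lra.
- move=> u _; rewrite expR_ge0 expR_le1 oppr_le0 mulrA.
  by have /andP[] := t01 u.
apply: (@le_trans _ _ (\sum_(u < m) (2 * a u ^+ 2 + (a u * (K < x u)%R%:R + a u * E)))).
  apply: ler_sum => u _; rewrite mulrA -/(phi u) -/(psi u) -/(a u) -/(t u).
  have [p0 p1 p2 p3] := edge_prob_bounds i u.
  have /andP[f0 f1] := phi01 u; have /andP[g0 g1] := psi01 u.
  have /andP[t0 ta] := t01 u.
  have h1 : `|phi u - psi u| <= (K < x u)%R%:R + E.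
    case: ltP => xK /=; last by rewrite add0r; exact: phi_psi.
    by rewrite ler_norml; apply/andP; split; lra.
  have h2 := expRN_dist t0.
  have h3 : t u ^+ 2 <= a u ^+ 2 by rewrite ler_pXn2r// nnegrE.
  (* The three brackets are the error in [p i u], the error in [phi u], and the second-order error
     of the exponential. *)
  have -> : 1 - p i u * (1 - phi u) - expR (- t u) =
     (a u - p i u) * (1 - phi u) + (a u * (phi u - psi u) -
     (expR (- t u) - (1 - t u))).
    by rewrite /t; ring.
  rewrite (le_trans (ler_normD _ _))//.
  have h4 : `|(a u - p i u) * (1 - phi u)| <= a u ^+ 2.
    rewrite normrM distrC (le_trans _ p3)// ler_piMr// ger0_norm; lra.
  have h5 : `|a u * (phi u - psi u)| <= a u * (K < x u)%R%:R + a u * E.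
    by rewrite normrM ger0_norm// -mulrDr ler_wpM2l.
  have := ler_normB (a u * (phi u - psi u)) (expR (- t u) - (1 - t u)).
  lra.
rewrite !big_split/= -mulr_sumr addrA; apply: lerD; first apply: lerD.
- rewrite -mulrA ler_wpM2l// /SX2 mulr_sumr le_eqVlt; apply/orP; left; apply/eqP.
  by apply: eq_bigr => u _; rewrite /a; field; rewrite gt_eqF.
- rewrite /TX mulr_sumr [leRHS]big_mkcond le_eqVlt; apply/orP; left; apply/eqP.
  apply: eq_bigr => u _; rewrite /a; case: ifP => _; rewrite ?mulr0// mulr1.
  by rewrite mulrAC mulrA.
- rewrite -mulr_suml ler_wpM2r// /SX mulr_sumr le_eqVlt; apply/orP; left; apply/eqP.
  by apply: eq_bigr => u _; rewrite /a mulrAC mulrA.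
Qed.

(** Below the cutoff each edge at row [j] has probability at most [y j / mu * K], and there are at
    most [m ^ 2] pairs of columns. The cutoff thus replaces sums of [x u ^+ 2], which are not
    bounded at this order. *)
Lemma clash_estimate :
  \sum_(u < m | K < x u) p i u +
  \sum_(j < n | j != i) \sum_(u < m | ~~ (K < x u)) \sum_(v < m | ~~ (K < x v) && (v != u))
    p i u * p i v * (p j u * p j v) <=
  y i * TX + y i ^+ 2 * K ^+ 4 * (m%:R / mu) ^+ 2 * SY2.
Proof.
apply: lerD.
  rewrite /TX mulr_sumr; apply: ler_sum => u _.
  by have [_ _ p2 _] := edge_prob_bounds i u; rewrite (le_trans p2)// mulrAC mulrA.
pose b j := y j / mu * K.
have b0 j : 0 <= b j by rewrite mulr_ge0.
have pb (j : 'I_n) (u : 'I_m) : ~~ (K < x u) -> 0 <= p j u <= b j.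
  rewrite -leNgt => xK; have [-> _ p2 _] := edge_prob_bounds j u.
  by rewrite (le_trans p2)// ler_wpM2l.
apply: (@le_trans _ _ (\sum_(j < n) \sum_(u < m) \sum_(v < m) (b i ^+ 2 * b j ^+ 2))).
  rewrite [leLHS]big_mkcond; apply: ler_sum => j _.
  have bb0 : 0 <= b i ^+ 2 * b j ^+ 2 by rewrite mulr_ge0 ?sqr_ge0.
  case: ifP => _; last by rewrite !sumr_ge0// => u _; rewrite sumr_ge0.
  rewrite [leLHS]big_mkcond; apply: ler_sum => u _.
  case: ifP => Ku; last by rewrite sumr_ge0.
  rewrite [leLHS]big_mkcond; apply: ler_sum => v _.
  case: ifP => // /andP[Kv _].
  have mm (a1 a2 b' : R) : 0 <= a1 <= b' -> 0 <= a2 <= b' -> 0 <= a1 * a2 <= b' ^+ 2.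
    by move=> /andP[? ?] /andP[? ?]; rewrite mulr_ge0// expr2 ler_pM.
  have /andP[? ?] := mm _ _ _ (pb i u Ku) (pb i v Kv).
  have /andP[? ?] := mm _ _ _ (pb j u Ku) (pb j v Kv).
  exact: ler_pM.
under eq_bigr do rewrite !sumr_const !card_ord -mulrnA -mulr_natr.
rewrite le_eqVlt; apply/orP; left; apply/eqP.
rewrite /SY2 mulr_sumr; apply: eq_bigr => j _; rewrite /b natrM.
by field; rewrite gt_eqF.
Qed.

End pgf_estimate.

(** * Limits *)

Section empirical_integrals.
Context {R : realType}.
Implicit Types (x : nat -> R) (f : R -> R).

Lemma integral_empirical x N (D : set R) f : measurable D ->
  measurable_fun D f -> (forall s, D s -> 0 <= f s) ->
  (\int[empirical x N]_(s in D) (f s)%:E =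
    ((\sum_(u < N) \1_D (x u) * f (x u)) / N%:R)%:E)%E.
Proof.
move=> mD mf f0; have mfE : measurable_fun D (EFin \o f) by exact/measurable_EFinP.
rewrite ge0_integral_mscale//.
rewrite ge0_integral_measure_sum//.
under eq_bigr => u _ do rewrite integral_dirac// diracE -EFinM.
by rewrite sumEFin -EFinM /= mulrC; congr (_ * _)%:E; apply: eq_bigr => u _.
Qed.

Lemma integral_empiricalT x N f : measurable_fun setT f -> (forall s, 0 <= f s) ->
  (\int[empirical x N]_s (f s)%:E = ((\sum_(u < N) f (x u)) / N%:R)%:E)%E.
Proof.
move=> mf f0; rewrite integral_empirical//; congr (_ / _)%:E.
by apply: eq_bigr => u _; rewrite indicT mul1r.
Qed.

Lemma weak_cvg_mean x (m : nat -> nat) (PX : probability R R) f M :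
  weak_cvg (fun n => empirical x (m n)) PX ->
  continuous f -> (forall s, 0 <= f s <= M) ->
  (\sum_(u < m n) f (x u)) / (m n)%:R @[n --> \oo] --> (\int[PX]_s f s)%R.
Proof.
move=> PXw cf fM.
have f0 s : 0 <= f s by have /andP[] := fM s.
have mf : measurable_fun setT f by exact: continuous_measurable_fun.
have := PXw f cf.
have bf : exists M, forall s, `|f s| <= M.
  by exists M => s; rewrite ger0_norm//; have /andP[] := fM s.
move=> /(_ bf).
under eq_fun do rewrite integral_empiricalT//.
have fin : (\int[PX]_s (f s)%:E)%E \is a fin_num.
  apply: integrable_fin_num => //; apply: (bounded_integrable_prob PX (M := M)) => // s.
  by rewrite ger0_norm//; have /andP[] := fM s.
rewrite -(fineK fin); exact: fine_cvg.
Qed.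

End empirical_integrals.

(** * Damped first moments and the support of the weak limit *)

Section damped_mean.
Context {R : realType}.

(** On positive [s], [s - damped e s] is [s * (1 - expR (- (e * s)))], the summand of the limiting
    exponent when [e = (1 - z) * ay / gamma]. Small [e] serves for tail bounds. *)
Definition damped (e s : R) : R := `|s| * expR (- (e * `|s|)).

Lemma damped_ge0 e s : 0 <= damped e s.
Proof. by rewrite mulr_ge0// expR_ge0. Qed.

Lemma damped_le e s : 0 <= e -> damped e s <= `|s|.
Proof. by move=> e0; rewrite ler_piMr// expR_le1 oppr_le0 mulr_ge0. Qed.

Lemma damped_bounded e s : 0 < e -> damped e s <= e^-1.
Proof.
move=> e0; rewrite /damped expRN ler_pdivrMr ?expR_gt0// ler_pdivlMl//.
by rewrite (le_trans _ (expR_ge1Dx _))// lerDr.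
Qed.

Lemma continuous_damped e : continuous (damped e).
Proof.
move=> s; apply: cvgM; first exact: norm_continuous.
apply: continuous_comp; last exact: continuous_expR.
apply: cvgN; apply: cvgMr; exact: norm_continuous.
Qed.

(** Beyond [1 / e] damping removes at least half of [s], so a small mean gap forces a small tail. *)
Lemma damped_gap e s : 0 <= s -> 1 <= e * s -> s <= 2 * (s - damped e s).
Proof.
move=> s0 es; rewrite /damped ger0_norm//.
have : expR (- (e * s)) <= 2^-1.
  rewrite expRN lef_pV2 ?posrE ?expR_gt0//.
  by rewrite (le_trans _ (expR_ge1Dx _))//; lra.
have := expR_ge0 (- (e * s)); nra.
Qed.

Variables (x : nat -> R) (m : nat -> nat) (PX : probability R R) (ax : R).
Hypothesis x_gt0 : forall u, 0 < x u.
Hypothesis PX_cvg : weak_cvg (fun n => empirical x (m n)) PX.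
Hypothesis PX_int : PX.-integrable setT (fun s : R => s%:E).
Hypothesis ax_def : (\int[PX]_s s%:E = ax%:E)%E.

Let dmean e := (\int[PX]_s damped e s)%R.

Lemma damped_cvg e : 0 < e ->
  (\sum_(u < m n) damped e (x u)) / (m n)%:R @[n --> \oo] --> dmean e.
Proof.
move=> e0; apply: (weak_cvg_mean (M := e^-1)) => //.
  exact: continuous_damped.
by move=> s; rewrite damped_ge0 damped_bounded.
Qed.

(** The test function [f] vanishes at every [x u] and is positive on the negative half-line; its
    exponential factor keeps it bounded. Its integral under the limit is therefore 0. *)
Lemma weak_limit_ge0 : {ae PX, forall s : R, 0 <= s}.
Proof.
pose f (s : R) : R := (`|s| - s) * expR (- `|s|).
have f02 s : 0 <= f s <= 2.
  rewrite mulr_ge0 ?expR_ge0 ?subr_ge0 ?ler_norm//=.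
  have := @damped_bounded 1 s ltr01; rewrite /damped mul1r invr1 => d1.
  have : (`|s| - s) * expR (- `|s|) <= (2 * `|s|) * expR (- `|s|).
    by rewrite ler_wpM2r ?expR_ge0//; have := ler_norm (- s); rewrite normrN; lra.
  by rewrite /f; lra.
have cf : continuous f.
  move=> s; apply: cvgM; first by apply: cvgB; [exact: norm_continuous|exact: cvg_id].
  apply: continuous_comp; last exact: continuous_expR.
  by apply: cvgN; exact: norm_continuous.
have mf : measurable_fun setT (EFin \o f).
  by apply/measurable_EFinP; exact: continuous_measurable_fun.
have fx u : f (x u) = 0.
  by rewrite /f gtr0_norm// subrr mul0r.
have f_int0 : (\int[PX]_s (f s)%:E = 0)%E.
  have := PX_cvg cf (ex_intro _ 2 _).
  have -> : (fun n => \int[empirical x (m n)]_s (f s)%:E)%E = cst 0%E.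
    apply/funext => n; rewrite integral_empiricalT.
    - by rewrite big1 ?mul0r// => u _.
    - exact: continuous_measurable_fun.
    - by move=> s; have /andP[] := f02 s.
  move=> H; have {}H : cst 0%E @ \oo --> (\int[PX]_s (f s)%:E)%E.
    by apply: H => s; have /andP[? ?] := f02 s; rewrite ger0_norm.
  by rewrite -(cvg_lim _ H)// lim_cst.
have : (\int[PX]_s `|(EFin \o f) s| = 0)%E.
  rewrite -f_int0; apply: eq_integral => s _ /=.
  by rewrite ger0_norm//; have /andP[] := f02 s.
move=> /(ae_eq_integral_abs PX measurableT mf).
apply: filterS => s /= /(_ I)[] fs; rewrite leNgt; apply/negP => s0.
move: fs => /eqP; rewrite /f mulf_eq0 expR_eq0 orbF ltr0_norm//.
by rewrite gt_eqF//; lra.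
Qed.

(** The two arguments of [g] allow the absolute value to be put on chosen occurrences of [s]
    only. *)
Lemma integral_weak_limit (g : R -> R -> R) :
  measurable_fun setT (fun s => g s s) -> measurable_fun setT (fun s => g s `|s|) ->
  (\int[PX]_s (g s s)%:E = \int[PX]_s (g s `|s|)%:E)%E.
Proof.
move=> mg mg'; apply: ae_eq_integral => //; [exact/measurable_EFinP..|].
by apply: filterS weak_limit_ge0 => s s0 _ /=; rewrite ger0_norm.
Qed.

Lemma norm_mean : (\int[PX]_s `|s|%:E = ax%:E)%E.
Proof.
rewrite -ax_def; apply/esym; apply: (integral_weak_limit (g := fun _ s => s)).
  exact: measurable_id.
by apply: continuous_measurable_fun; exact: norm_continuous.
Qed.

(** Dominated convergence with [|s|] as the bound. *)
Lemma damped_mean_cvg0 : dmean k.+1%:R^-1 @[k --> \oo] --> ax.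
Proof.
have cvgE : (\int[PX]_s (damped k.+1%:R^-1 s)%:E)%E @[k --> \oo] --> (\int[PX]_s `|s|%:E)%E.
  apply: (@dominated_cvg _ _ _ PX setT measurableT
    (fun k s => (damped k.+1%:R^-1 s)%:E) (fun s => `|s|%:E) (fun s => `|s|%:E)) => //.
  - move=> k; apply/measurable_EFinP; apply: continuous_measurable_fun.
    exact: continuous_damped.
  - move=> s _.
    have H : damped k.+1%:R^-1 s @[k --> \oo] --> `|s|.
      rewrite (_ : `|s| = `|s| * expR 0); last by rewrite expR0 mulr1.
      apply: cvgM; first exact: cvg_cst.
      apply: continuous_cvg; first exact: continuous_expR.
      rewrite -[X in _ --> X]oppr0; apply: cvgN.
      rewrite -[X in _ --> X](mul0r `|s|); apply: cvgMl.
      exact: cvg_harmonic.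
    by apply: cvg_EFin H; near=> k.
  - exact: (integrable_norm (f := idfun)).
  - by move=> k s _; rewrite gee0_abs ?lee_fin ?damped_ge0// damped_le ?invr_ge0.
move: cvgE; rewrite norm_mean; exact: fine_cvg.
Unshelve. all: by end_near.
Qed.

End damped_mean.

Section second_moment.
Context {R : realType} (a : nat -> R) (N : nat -> nat) (mu : nat -> R) (s : R).
Hypothesis a_ge0 : forall k, 0 <= a k.
Hypothesis mu_gt0 : \forall n \near \oo, 0 < mu n.
Hypothesis mu_cvg : (mu n)^-1 @[n --> \oo] --> (0 : R).
Hypothesis s_cvg : \sum_(k < N n) a k / mu n @[n --> \oo] --> s.
Hypothesis a_tail : forall e : R, 0 < e -> exists2 K : R, 0 <= K &
  \forall n \near \oo, \sum_(k < N n | K < a k) a k / mu n <= e.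

(* [a_k^2 <= K a_k] for the small terms, and the squares of the large ones sum
   to at most the square of their sum. *)
Lemma second_moment_cvg0 :
  \sum_(k < N n) (a k / mu n) ^+ 2 @[n --> \oo] --> (0 : R).
Proof.
apply/cvgrPdist_le => e e0.
(* With the tail sum [T <= 1] and [T <= e / 2], also [T ^+ 2 <= T <= e / 2]. *)
pose e1 := Num.min 1 (e / 2).
have e10 : 0 < e1 by rewrite lt_min ltr01 divr_gt0.
have [K K0 Ktail] := a_tail e10.
have ks : K * ((\sum_(k < N n) a k / mu n) * (mu n)^-1) @[n --> \oo] --> K * (s * 0).
  by apply: cvgMr; exact: cvgM.
near=> n.
have mun : 0 < mu n by near: n.
have b0 k : 0 <= a k / mu n by rewrite divr_ge0// ltW.
have T1 : \sum_(k < N n | K < a k) a k / mu n <= e1 by near: n.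
set T := \sum_(k < N n | K < a k) a k / mu n in T1.
have T0 : 0 <= T by apply: sumr_ge0.
have TT : T ^+ 2 <= e / 2.
  apply: (le_trans (y := e1)); last by rewrite ge_min lexx orbT.
  rewrite expr2 (le_trans _ T1)// ler_piMl// (le_trans T1)// ge_min lexx//.
have S1 : K * ((\sum_(k < N n) a k / mu n) * (mu n)^-1) <= e / 2.
  near: n; apply: (cvgr_le _ ks); rewrite !mulr0; lra.
rewrite sub0r normrN ger0_norm; last by apply: sumr_ge0 => k _; exact: sqr_ge0.
rewrite (bigID (fun k : 'I_(N n) => K < a k))/=.
have l1 : \sum_(k < N n | K < a k) (a k / mu n) ^+ 2 <= T ^+ 2.
  rewrite [leRHS]expr2 /T mulr_suml; apply: ler_sum => k Kk.
  rewrite expr2 ler_wpM2l// (bigD1 k)//= lerDl.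
  by apply: sumr_ge0.
have l2 : \sum_(k < N n | ~~ (K < a k)) (a k / mu n) ^+ 2 <=
    K * ((\sum_(k < N n) a k / mu n) * (mu n)^-1).
  rewrite mulr_suml mulr_sumr [leLHS]big_mkcond; apply: ler_sum => k _.
  case: ifPn => [|_]; last by rewrite !mulr_ge0 ?invr_ge0 ?(ltW mun).
  rewrite -leNgt => akK.
  rewrite (_ : K * _ = a k / mu n * (K / mu n)); last by ring.
  by rewrite expr2 ler_wpM2l// ler_wpM2r// invr_ge0 ltW.
lra.
Unshelve. all: by end_near.
Qed.

End second_moment.

(** * Asymptotics of the scale [mu] *)

Section scaling_limits.
Context {R : realType} (m : nat -> nat) (gamma : R).
Hypothesis gamma_gt0 : 0 < gamma.
Hypothesis m_cvg : ((m n)%:R / n%:R : R) @[n --> \oo] --> gamma ^+ 2.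

Definition edge_scale n : R := Num.sqrt (n * m n)%:R.

Local Notation mu := edge_scale.

Lemma m_gt0_near : \forall n \near \oo, (0 < m n)%N.
Proof.
near=> n; rewrite lt0n; apply/eqP => mn0.
have : 0 < (m n)%:R / n%:R :> R.
  by near: n; apply: (cvgr_gt _ m_cvg); rewrite exprn_gt0.
by rewrite mn0 mul0r ltxx.
Unshelve. all: by end_near.
Qed.

Lemma edge_scale_gt0_near : \forall n \near \oo, 0 < mu n.
Proof.
near=> n; rewrite sqrtr_gt0 ltr0n muln_gt0; apply/andP; split.
  by near: n; exists 1%N.
by near: n; exact: m_gt0_near.
Unshelve. all: by end_near.
Qed.

Lemma n_over_scale_cvg : n%:R / mu n @[n --> \oo] --> gamma^-1.
Proof.
have H : Num.sqrt ((m n)%:R / n%:R) @[n --> \oo] --> gamma.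
  rewrite -[X in _ --> X](ger0_norm (ltW gamma_gt0)) -sqrtr_sqr.
  by apply: continuous_cvg => //; exact: sqrt_continuous.
have /(cvgV (lt0r_neq0 gamma_gt0)) := H.
apply: cvg_trans; apply: near_eq_cvg; near=> n.
have n0 : 0 < n%:R :> R by rewrite ltr0n; near: n; exists 1%N.
have mun : 0 < mu n by near: n; exact: edge_scale_gt0_near.
have muE : mu n = n%:R * Num.sqrt ((m n)%:R / n%:R).
  rewrite /edge_scale -[X in X * _](ger0_norm (ltW n0)) -sqrtr_sqr.
  rewrite -sqrtrM ?sqr_ge0// natrM; congr Num.sqrt.
  by field; rewrite gt_eqF.
have s0 : Num.sqrt ((m n)%:R / n%:R) != 0 :> R.
  by apply: contraTneq mun => s0; rewrite muE s0 mulr0 ltxx.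
rewrite muE; set r := Num.sqrt _ in s0 *.
by rewrite invfM mulrA divff ?mul1r// gt_eqF.
Unshelve. all: by end_near.
Qed.

Lemma m_over_scale_cvg : (m n)%:R / mu n @[n --> \oo] --> gamma.
Proof.
have -> : gamma = gamma ^+ 2 * gamma^-1.
  by rewrite expr2 mulfK// gt_eqF.
have : (m n)%:R / n%:R * (n%:R / mu n) @[n --> \oo] --> gamma ^+ 2 * gamma^-1.
  by apply: cvgM => //; exact: n_over_scale_cvg.
apply: cvg_trans; apply: near_eq_cvg; near=> n.
have n0 : 0 < n%:R :> R by rewrite ltr0n; near: n; exists 1%N.
by rewrite mulrA divfK// gt_eqF.
Unshelve. all: by end_near.
Qed.

Lemma inv_scale_cvg0 : (mu n)^-1 @[n --> \oo] --> (0 : R).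
Proof.
rewrite -(mul0r gamma^-1).
have h0 : (n%:R : R)^-1 @[n --> \oo] --> 0.
  by rewrite -(cvg_shiftS (fun n => n%:R^-1 : R^o)); exact: cvg_harmonic.
have : n%:R^-1 * (n%:R / mu n) @[n --> \oo] --> 0 * gamma^-1.
  by apply: cvgM => //; exact: n_over_scale_cvg.
apply: cvg_trans; apply: near_eq_cvg; near=> n.
have n0 : 0 < n%:R :> R by rewrite ltr0n; near: n; exists 1%N.
by rewrite mulKf// gt_eqF.
Unshelve. all: by end_near.
Qed.

End scaling_limits.

Lemma sum_over_scale {R : realType} (a : nat -> R) (N : nat) (mu : R) :
  \sum_(u < N) a u / mu = (\sum_(u < N) a u) / N%:R * (N%:R / mu).
Proof.
rewrite -mulr_suml; have [->|N0] := eqVneq N 0%N; first by rewrite big_ord0 !mul0r.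
by rewrite mulrA divfK// pnatr_eq0.
Qed.

(** An integer-valued twin of [degree], to which [pgf_continuity] applies. *)
Definition degree_nat (n m i : nat) (h : bigraph n m) : nat :=
  if insub i is Some v then #|affiliation_adj h v| else 0%N.

HB.instance Definition _ (n m i : nat) := isMeasurableFun.Build _ _ _ _
  (@degree_nat n m i) ((fun _ _ _ => I) : measurable_fun setT (@degree_nat n m i)).

(** * Convergence of the generating function of the degree *)

Section degree_pgf.
Context {R : realType} (x y : nat -> R) (m : nat -> nat) (gamma : R).
Hypotheses (x_gt0 : forall u, 0 < x u) (y_gt0 : forall i, 0 < y i).
Hypothesis gamma_gt0 : 0 < gamma.
Hypothesis m_cvg : ((m n)%:R / n%:R : R) @[n --> \oo] --> gamma ^+ 2.
Variables (PX : probability R R) (ax : R).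
Hypothesis PX_cvg : weak_cvg (fun n => empirical x (m n)) PX.
Hypothesis PX_int : PX.-integrable setT (fun s : R => s%:E).
Hypothesis ax_def : (\int[PX]_s s%:E = ax%:E)%E.
Hypothesis ax_cvg : (\sum_(u < m n) x u) / (m n)%:R @[n --> \oo] --> ax.
Hypothesis y_ui : uniformly_integrable (empirical y).
Variable ay : R.
Hypothesis ay_gt0 : 0 < ay.
Hypothesis ay_cvg : (\sum_(i < n) y i) / n%:R @[n --> \oo] --> ay.

Local Notation mu := (@edge_scale R m).
Let dmean e := (\int[PX]_s damped e s)%R.
Let c := ay / gamma.

Let x_ge0 u : 0 <= x u. Proof. exact: ltW. Qed.
Let y_ge0 j : 0 <= y j. Proof. exact: ltW. Qed.
Let c_gt0 : 0 < c. Proof. by rewrite divr_gt0. Qed.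

Let SX_cvg : \sum_(u < m n) x u / mu n @[n --> \oo] --> ax * gamma.
Proof.
under eq_fun do rewrite sum_over_scale.
by apply: cvgM => //; exact: m_over_scale_cvg.
Qed.

Let SY_cvg : \sum_(j < n) y j / mu n @[n --> \oo] --> c.
Proof.
under eq_fun do rewrite sum_over_scale.
by apply: cvgM => //; exact: n_over_scale_cvg.
Qed.

(** Used twice: with small [e] for [x_tail], and with [e = (1 - z) * c] for the limiting
    exponent. *)
Let gap_cvg e : 0 < e ->
  \sum_(u < m n) (x u - damped e (x u)) / mu n @[n --> \oo] --> (ax - dmean e) * gamma.
Proof.
move=> e0; under eq_fun do rewrite (sum_over_scale (fun u => x u - damped e (x u))).
apply: cvgM; last exact: m_over_scale_cvg.
have -> : (fun n => (\sum_(u < m n) (x u - damped e (x u))) / (m n)%:R) =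
    (fun n => (\sum_(u < m n) x u) / (m n)%:R -
              (\sum_(u < m n) damped e (x u)) / (m n)%:R).
  by apply/funext => n; rewrite sumrB mulrBl.
by apply: cvgB => //; exact: damped_cvg.
Qed.

(** Uniform integrability of [x]: the undamped means converge to the mean of the limit law, so for
    weak damping the mean gap is eventually small, and [damped_gap] bounds the tail by twice that
    gap. *)
Let x_tail (e : R) : 0 < e -> exists2 K : R, 0 <= K &
  \forall n \near \oo, \sum_(u < m n | K < x u) x u / mu n <= e.
Proof.
move=> e0.
(* The limiting gap is then at most [e / 4], strictly below the [e / 2] that the factor 2 of
   [damped_gap] allows. *)
have g0 : 0 < e / (4 * gamma) by rewrite divr_gt0// mulr_gt0.
have [k dk] : exists k, ax - e / (4 * gamma) <= dmean k.+1%:R^-1.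
  near \oo => k; exists k; near: k.
  apply: (cvgr_ge _ (damped_mean_cvg0 x_gt0 PX_cvg PX_int ax_def)); lra.
exists k.+1%:R => //; near=> n.
have mun : 0 < mu n by near: n; exact: edge_scale_gt0_near m_cvg.
apply: (@le_trans _ _ (2 * \sum_(u < m n) (x u - damped k.+1%:R^-1 (x u)) / mu n)).
  rewrite mulr_sumr [leLHS]big_mkcond; apply: ler_sum => u _.
  have gap0 : 0 <= x u - damped k.+1%:R^-1 (x u).
    rewrite subr_ge0 (le_trans (damped_le _ _)) ?invr_ge0//.
    by rewrite ger0_norm.
  case: ifPn => [kx|_]; last by rewrite !mulr_ge0// invr_ge0 ltW.
  rewrite mulrA ler_wpM2r ?invr_ge0 ?(ltW mun)// damped_gap//.
  by rewrite mulrC ler_pdivlMr// mul1r ltW.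
have : \sum_(u < m n) (x u - damped k.+1%:R^-1 (x u)) / mu n <= e / 2.
  near: n; apply: (cvgr_le _ (gap_cvg _)); rewrite ?invr_gt0 ?ltr0n//.
  have h1 : (ax - dmean k.+1%:R^-1) * gamma <= e / (4 * gamma) * gamma.
    by rewrite ler_wpM2r ?(ltW gamma_gt0)//; lra.
  have h2 : e / (4 * gamma) * gamma = e / 4 by field; rewrite gt_eqF.
  by apply: (le_lt_trans h1); rewrite h2; lra.
lra.
Unshelve. all: by end_near.
Qed.

Let y_tail (e : R) : 0 < e -> exists2 K : R, 0 <= K &
  \forall n \near \oo, \sum_(j < n | K < y j) y j / mu n <= e.
Proof.
(* [n / mu] tends to [1 / gamma], so it is eventually at most [2 / gamma]. *)
move=> e0; have e1 : 0 < e * gamma / 2 by rewrite divr_gt0// mulr_gt0.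
have [K [K0 HK]] : exists K : R, 0 <= K /\ (ereal_sup
   [set \int[empirical y n]_(s in `]K, +oo[) s%:E | n in [set n | (0 < n)%N]]
   <= (e * gamma / 2)%:E)%E.
  near (+oo : set_system R) => K; exists K; split; first by near: K; exact: nbhs_pinfty_ge.
  near: K; move/fine_cvgP : y_ui => [fin H].
  near=> K; rewrite -(fineK (x := ereal_sup _)); last by near: K.
  by rewrite lee_fin; near: K; apply: (cvgr_le _ H).
exists K => //; near=> n.
have n0 : (0 < n)%N by near: n; exists 1%N.
have mun : 0 < mu n by near: n; exact: edge_scale_gt0_near m_cvg.
have : (\int[empirical y n]_(s in `]K, +oo[) s%:E <= (e * gamma / 2)%:E)%E.
  by apply: le_trans HK; apply: ereal_sup_ubound; exists n.
rewrite integral_empirical//; last first.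
  by move=> s /=; rewrite in_itv/= andbT => /ltW; exact: le_trans.
rewrite lee_fin => tn.
have -> : \sum_(j < n | K < y j) y j / mu n =
    (\sum_(u < n) \1_(`]K, +oo[%classic) (y u) * y u) / n%:R * (n%:R / mu n).
  rewrite -(sum_over_scale (fun u => \1_(`]K, +oo[%classic) (y u) * y u)).
  rewrite big_mkcond; apply: eq_bigr => j _; rewrite indicE mem_setE in_itv/= andbT.
  by case: ifP => _; rewrite ?mul1r// !mul0r.
have nm : n%:R / mu n <= 2 / gamma.
  near: n; apply: (cvgr_le _ (n_over_scale_cvg gamma_gt0 m_cvg)).
  by rewrite -[ltLHS]mul1r ltr_pM2r ?invr_gt0// ltr1n.
apply: (@le_trans _ _ (e * gamma / 2 * (2 / gamma))).
  apply: ler_pM => //; last by rewrite divr_ge0// ltW.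
  by rewrite divr_ge0// sumr_ge0// => u _; rewrite mulr_ge0.
by rewrite le_eqVlt; apply/orP; left; apply/eqP; field; rewrite gt_eqF.
Unshelve. all: by end_near.
Qed.

Variable (G : forall n, probability (bigraph n (m n)) R).
Hypothesis G_indep : forall n,
  independent_edges (@edge_prob R y x (mu n) n (m n)) (G n).

Lemma degree_pgf_cvg (i : nat) (z : R) : 0 < z < 1 ->
  graph_mean (G n) (fun h => z ^+ degree_nat i h) @[n --> \oo] -->
  expR (- (y i * gamma * (ax - dmean ((1 - z) * c)))).
Proof.
move=> /andP[z0 z1]; set w := 1 - z.
have w0 : 0 < w by rewrite subr_gt0.
have w1 : w <= 1 by rewrite gerBl ltW.
have wc0 : 0 < w * c by rewrite mulr_gt0.
have mu0 : \forall n \near \oo, 0 < mu n by exact: edge_scale_gt0_near m_cvg.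
have imu := inv_scale_cvg0 gamma_gt0 m_cvg.
have SX2 := second_moment_cvg0 x_ge0 mu0 imu SX_cvg x_tail.
have SY2 := second_moment_cvg0 (N := id) y_ge0 mu0 imu SY_cvg y_tail.
pose L n := expR (- (y i / mu n * \sum_(u < m n) x u * (1 - expR (- (w * c * x u))))).
have L_cvg : L n @[n --> \oo] --> expR (- (y i * gamma * (ax - dmean (w * c)))).
  suff H : - (y i / mu n * \sum_(u < m n) x u * (1 - expR (- (w * c * x u))))
      @[n --> \oo] --> - (y i * gamma * (ax - dmean (w * c))).
    exact: (cvg_comp _ _ H (@continuous_expR R _)).
  apply: cvgN.
  have -> : (fun n => y i / mu n * \sum_(u < m n) x u * (1 - expR (- (w * c * x u)))) =
      (fun n => y i * \sum_(u < m n) (x u - damped (w * c) (x u)) / mu n).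
    apply/funext => n; rewrite -mulrA; congr (_ * _); rewrite mulr_sumr.
    by apply: eq_bigr => u _; rewrite /damped ger0_norm//; ring.
  rewrite -mulrA [gamma * _]mulrC; apply: cvgMr; exact: gap_cvg.
apply/cvgrPdist_le => e e0.
pose yi := y i; have yi0 : 0 < yi by exact: y_gt0.
(* The tail above [K] enters twice, through [clash_estimate] and [pgf_estimate], each time costing
   [e / 8]. *)
have e8 : 0 < e / (8 * yi) by rewrite divr_gt0// mulr_gt0.
have [K K0 TK] := x_tail e8.
(* All the remaining errors of the two estimates; for fixed [K] they vanish as [n] grows. *)
pose Err n := 2 * yi ^+ 2 * (\sum_(u < m n) (x u / mu n) ^+ 2) +
  (yi * (\sum_(u < m n) x u / mu n) *
    (2 * K ^+ 2 * (\sum_(j < n) (y j / mu n) ^+ 2) +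
     K * (`|(\sum_(j < n) y j / mu n) - c| + yi * (mu n)^-1)) +
  yi ^+ 2 * K ^+ 4 * ((m n)%:R / mu n) ^+ 2 * (\sum_(j < n) (y j / mu n) ^+ 2)).
have Err_cvg : Err n @[n --> \oo] --> (0 : R).
  have -> : (0 : R) = 2 * yi ^+ 2 * 0 + (yi * (ax * gamma) *
      (2 * K ^+ 2 * 0 + K * (`|c - c| + yi * 0)) +
      yi ^+ 2 * K ^+ 4 * gamma ^+ 2 * 0).
    by rewrite subrr normr0 !(mulr0, addr0).
  apply: cvgD; first exact: cvgMr.
  apply: cvgD.
    apply: cvgM; first by apply: cvgMr; exact: SX_cvg.
    apply: cvgD; first exact: cvgMr.
    apply: cvgMr; apply: cvgD; last exact: cvgMr.
    by apply: cvg_norm; apply: cvgB => //; exact: cvg_cst.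
  apply: cvgM; last exact: SY2.
  by apply: cvgMr; rewrite expr2; apply: cvgM; exact: m_over_scale_cvg.
near=> n.
have lin : (i < n)%N by near: n; exists i.+1.
have mun : 0 < mu n by near: n.
have TX : \sum_(u < m n | K < x u) x u / mu n <= e / (8 * yi) by near: n.
have Le : `|expR (- (y i * gamma * (ax - dmean (w * c)))) - L n| <= e / 4.
  by near: n; move/cvgrPdist_le : L_cvg; apply; rewrite divr_gt0.
have Ee : Err n <= e / 4 by near: n; apply: (cvgr_le _ Err_cvg); rewrite divr_gt0.
have degE h : degree_nat i h = #|affiliation_adj h (Ordinal lin)|.
  by rewrite /degree_nat insubT.
under eq_fun do rewrite degE.
have z01 : 0 <= z <= 1 by rewrite !ltW.
have w01 : 0 <= w <= 1 by rewrite (ltW w0) w1.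
have A1 := graph_mean_zdegree (G_indep n) (Ordinal lin) z01 (fun u => K < x u).
have A2 := clash_estimate (m n) (Ordinal lin) x_ge0 y_ge0 mun K0.
have A3 := pgf_estimate (m n) (Ordinal lin) x_ge0 y_ge0 mun w01 (ltW c_gt0) K0.
have {A2}A1 := le_trans A1 A2.
have yT : yi * \sum_(u < m n | K < x u) x u / mu n <= e / 8.
  have -> : e / 8 = yi * (e / (8 * yi)) by field; rewrite gt_eqF.
  by rewrite ler_wpM2l// ltW.
move: A1 A3 Le Ee; rewrite /Err -/(L n) -/w /= -/yi.
set g := graph_mean _ _; set P := \prod_(u < m n) _; set l := expR _.
rewrite !ler_norml => /andP[? ?] /andP[? ?] /andP[? ?] ?.
by apply/andP; split; lra.
Unshelve. all: by end_near.
Qed.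

End degree_pgf.

(** * The jump law and the theorem *)

Lemma nat_probability {R : realType} (w : nat -> R) :
  (forall t, 0 <= w t) -> (\sum_(t <oo) (w t)%:E = 1)%E ->
  exists q : probability nat R, forall t, q [set t] = (w t)%:E.
Proof.
move=> w0 w1.
pose M := mseries (fun t => mscale (NngNum (w0 t)) (\d_t : {measure set nat -> \bar R})) 0.
have M1 : M setT = 1%E.
  rewrite -w1; apply: eq_eseriesr => t _.
  by rewrite /= /mscale/= diracT mule1.
pose q : probability nat R := HB.pack M (Measure_isProbability.Build _ _ R M M1).
exists q => t; rewrite /= /M /mseries.
rewrite (@nneseriesD1 _ _ t)//=.
rewrite /mscale/= diracE mem_set// mule1 eseries0 ?adde0// => k _ /= kt.
rewrite /mscale/= diracE memNset ?mule0// => tk.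
by move: kt; rewrite tk eqxx.
Qed.

Section size_biased.
Context {R : realType} (x : nat -> R) (m : nat -> nat) (PX : probability R R) (ax : R).
Hypothesis x_gt0 : forall u, 0 < x u.
Hypothesis PX_cvg : weak_cvg (fun n => empirical x (m n)) PX.
Hypothesis PX_int : PX.-integrable setT (fun s : R => s%:E).
Hypothesis ax_def : (\int[PX]_s s%:E = ax%:E)%E.
Hypothesis ax_gt0 : 0 < ax.
Variables (ay gamma : R).
Hypotheses (ay_gt0 : 0 < ay) (gamma_gt0 : 0 < gamma).

(** The Poisson weight at [t] with mean [s * ay / gamma], times the size-biasing density
    [s / ax]. *)
Let g (t : nat) (s : R) : R :=
  s / ax * expR (- (s * ay / gamma)) * ((s * ay / gamma) ^+ t / t`!%:R).

Let mg t : measurable_fun setT (g t).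
Proof.
have ml : measurable_fun setT (fun s : R => s * ay / gamma).
  by do 2 apply: measurable_funM => //.
apply: measurable_funM; first apply: measurable_funM.
- by apply: measurable_funM.
- by apply: measurableT_comp => //; exact: measurable_funN.
- by apply: measurable_funM => //; exact: measurable_funX.
Qed.

Let mnorm : measurable_fun setT (fun s : R => `|s|).
Proof. by apply: continuous_measurable_fun; exact: norm_continuous. Qed.

Let mgn t : measurable_fun setT (fun s : R => g t `|s|).
Proof. by apply: (measurableT_comp (f := g t)). Qed.

Let gn_ge0 t (s : R) : 0 <= g t `|s|.
Proof.
by rewrite !mulr_ge0 ?invr_ge0 ?exprn_ge0 ?mulr_ge0 ?expR_ge0 ?invr_ge0 ?(ltW ax_gt0)
  ?(ltW ay_gt0) ?(ltW gamma_gt0).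
Qed.

Let damped_int_fin e : 0 <= e -> (\int[PX]_s (damped e s)%:E)%E \is a fin_num.
Proof.
move=> e0; rewrite ge0_fin_numE; last first.
  by apply: integral_ge0 => s _; rewrite lee_fin damped_ge0.
apply: (@le_lt_trans _ _ (\int[PX]_s `|s|%:E)%E).
  apply: ge0_le_integral => //.
  - by move=> s _; rewrite lee_fin damped_ge0.
  - apply/measurable_EFinP; apply: continuous_measurable_fun.
    exact: continuous_damped.
  - exact/measurable_EFinP.
  - by move=> s _; rewrite lee_fin damped_le.
by rewrite (norm_mean x_gt0 PX_cvg ax_def) ltry.
Qed.

(** Summing under the integral, the Poisson weights of mean [l] give [expR (- ((1 - z) * l))], so
    the size-biased factor yields [damped] again. With [|s|] the terms are nonnegative everywhere,
    as the interchange requires. *)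
Let pgf_series (z : R) : 0 <= z ->
  (\sum_(t <oo) (\int[PX]_s (g t `|s|)%:E) * (z ^+ t)%:E =
   (ax^-1)%:E * \int[PX]_s (damped ((1 - z) * (ay / gamma)) s)%:E)%E.
Proof.
move=> z0.
rewrite -ge0_integralZl//; last 3 first.
- apply/measurable_EFinP; apply: continuous_measurable_fun.
  exact: continuous_damped.
- by move=> s _; rewrite lee_fin damped_ge0.
- by rewrite lee_fin invr_ge0 ltW.
transitivity (\sum_(t <oo) \int[PX]_s (g t `|s| * z ^+ t)%:E)%E.
  apply: eq_eseriesr => t _.
  rewrite -ge0_integralZr//; last 3 first.
  - exact/measurable_EFinP.
  - by move=> s _; rewrite lee_fin.
  - by rewrite lee_fin exprn_ge0.
rewrite -integral_nneseries//; last 2 first.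
- by move=> t; apply/measurable_EFinP; exact: measurable_funM.
- by move=> t s _; rewrite lee_fin mulr_ge0 ?exprn_ge0.
apply: eq_integral => s _.
pose l := `|s| * ay / gamma.
have l0 : 0 <= l by rewrite !mulr_ge0 ?invr_ge0 ?(ltW ay_gt0) ?(ltW gamma_gt0).
rewrite (eq_eseriesr (g := fun t => (`|s| / ax * expR (- l) * ((l * z) ^+ t / t`!%:R))%:E)).
  rewrite nneseries_expR; last 2 first.
  - by rewrite mulr_ge0 ?expR_ge0// divr_ge0// ltW.
  - exact: mulr_ge0.
  rewrite -EFinM; congr EFin; rewrite -[LHS]mulrA -expRD /damped.
  rewrite [RHS]mulrA [ax^-1 * _]mulrC; congr (_ * expR _).
  by rewrite /l; ring.
move=> t _; congr EFin; rewrite /g -/l [(l * z) ^+ t]exprMn.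
by set h := `|s| / ax * _; ring.
Qed.

Lemma size_biased_law : exists q : probability nat R,
  (forall t : nat, q [set t] = (\int[PX]_s (g t s)%:E)%E) /\
  (forall z : R, 0 <= z <= 1 -> fine (\int[q]_k (z ^+ k)%:E)%E =
    (\int[PX]_s damped ((1 - z) * (ay / gamma)) s)%R / ax).
Proof.
have s1 : (\sum_(t <oo) \int[PX]_s (g t `|s|)%:E = 1)%E.
  (* At [z = 1] the series is the total mass, and [damped 0 s] is [|s|], of mean [ax]. *)
  have := pgf_series ler01.
  under eq_eseriesr do rewrite expr1n mule1.
  move=> ->; under eq_integral do rewrite /damped subrr mul0r mul0r oppr0 expR0 mulr1.
  by rewrite (norm_mean x_gt0 PX_cvg ax_def) -EFinM mulVf// gt_eqF.
have int0 t : (0 <= \int[PX]_s (g t `|s|)%:E)%E.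
  by apply: integral_ge0 => s _; rewrite lee_fin.
have intE t : ((fine (\int[PX]_s (g t `|s|)%:E))%:E = \int[PX]_s (g t `|s|)%:E)%E.
  rewrite fineK// ge0_fin_numE// (@le_lt_trans _ _ 1%E) ?ltry//.
  rewrite -s1 (@nneseriesD1 _ _ t)//= leeDl// nneseries_ge0//.
have [||q qE] := @nat_probability R (fun t => fine (\int[PX]_s (g t `|s|)%:E)).
- by move=> t; rewrite fine_ge0.
- by under eq_eseriesr do rewrite intE.
exists q; split.
  move=> t; rewrite qE intE; apply/esym.
  exact: (integral_weak_limit x_gt0 PX_cvg (g := fun _ => g t)).
move=> z /andP[z0 z1].
rewrite integral_nat; last by move=> k; rewrite lee_fin exprn_ge0.
rewrite (eq_eseriesr (g := fun t =>
    (\int[PX]_s (g t `|s|)%:E * (z ^+ t)%:E)%E)); last first.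
  by move=> t _; congr (_ * _)%E; rewrite -intE; exact: qE.
rewrite pgf_series// /Rintegral fineM//.
  by rewrite mulrC.
by apply: damped_int_fin; rewrite mulr_ge0 ?divr_ge0 ?subr_ge0// ltW.
Qed.

End size_biased.

(* Sequences are indexed from 0: x u and y i stand for x_{u+1} and y_{i+1}. *)
Theorem theorem2 (R : realType) (x y : nat -> R)
  (x_gt0 : forall u, 0 < x u) (y_gt0 : forall i, 0 < y i)
  (m : nat -> nat) (gamma : R) (gamma_gt0 : 0 < gamma)
  (m_cvg : ((m n)%:R / n%:R : R) @[n --> \oo] --> gamma ^+ 2)
  (PX : probability R R) (ax : R)
  (PX_cvg : weak_cvg (fun n => empirical x (m n)) PX)
  (PX_int : PX.-integrable setT (fun s : R => s%:E))
  (ax_def : (\int[PX]_s s%:E = ax%:E)%E) (ax_gt0 : 0 < ax)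
  (ax_cvg : (\sum_(u < m n) x u) / (m n)%:R @[n --> \oo] --> ax)
  (y_ui : uniformly_integrable (empirical y))
  (ay : R) (ay_gt0 : 0 < ay)
  (ay_cvg : (\sum_(i < n) y i) / n%:R @[n --> \oo] --> ay)
  (G : forall n, probability (bigraph n (m n)) R)
  (G_indep : forall n, independent_edges
    (@edge_prob R y x (Num.sqrt (n * m n)%:R) n (m n)) (G n)) :
  exists (Q : probability R R),
    (forall t : nat,
      let lambda s := s * ay / gamma in
      Q [set t%:R] =
        (\int[PX]_s (s / ax * expR (- lambda s) * (lambda s ^+ t / t`!%:R))%:E)%E)
    /\ forall i : nat, exists CP : probability R R,
      compound_poisson (y i * ax * gamma) Q CP /\
      weak_cvg (fun n => distribution (G n) (@degree R n (m n) i)) CP.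
Proof.
have [q [q1 qpgf]] := size_biased_law x_gt0 PX_cvg ax_def ax_gt0 ay_gt0 gamma_gt0.
exists (distribution q (natR R)); split.
  move=> t /=; rewrite -q1 /distribution /pushforward; congr (q _).
  apply/seteqP; split => k /=; rewrite /natR; last by move=> ->.
  by move/eqP; rewrite eqr_nat => /eqP.
move=> i.
have lam_gt0 : 0 < y i * ax * gamma by rewrite !mulr_gt0.
have [c [cCP cpgf]] := compound_poisson_exists q lam_gt0.
exists (distribution c (natR R)); split => //.
pose p_ n : probability nat R := distribution (G n) (@degree_nat n (m n) i).
have pgf_cvg (z : R) : 0 < z < 1 ->
    (\int[p_ n]_k (z ^+ k)%:E)%E @[n --> \oo] --> (\int[c]_k (z ^+ k)%:E)%E.
  move=> z01; have z01' : 0 <= z <= 1 by case/andP: z01 => ? ?; rewrite !ltW.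
  have z0 : 0 <= z by case/andP: z01'.
  rewrite cpgf//.
  have -> : (fun n => \int[p_ n]_k (z ^+ k)%:E)%E =
      fun n => (graph_mean (G n) (fun h => z ^+ degree_nat i h))%:E.
    apply/funext => n; rewrite -graph_meanE.
    rewrite (ge0_integral_distribution (@degree_nat n (m n) i))// => k.
    by rewrite lee_fin exprn_ge0.
  have H := degree_pgf_cvg x_gt0 y_gt0 gamma_gt0 m_cvg PX_cvg PX_int ax_def ax_cvg
    y_ui ay_gt0 ay_cvg G_indep (i := i) z01.
  apply: cvg_EFin; first by near=> n.
  (* The factor [ax] of the intensity cancels the size-biasing normalization, so the exponents
     agree. *)
  rewrite qpgf// (_ : y i * ax * gamma * _ = y i * gamma *
    (ax - (\int[PX]_s damped ((1 - z) * (ay / gamma)) s)%R))//.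
  by field; rewrite gt_eqF.
move=> f cf [M fM].
have mf : measurable_fun setT (EFin \o f).
  by apply/measurable_EFinP; exact: continuous_measurable_fun.
have bf : nat_bounded (fun k => f (natR R k)) by exists M.
rewrite (integral_distribution (X := natR R) mf (nat_bounded_integrable c bf)).
have -> : (fun n => \int[distribution (G n) (@degree R n (m n) i)]_s (f s)%:E)%E =
    fun n => (\int[p_ n]_k (f (natR R k))%:E)%E.
  apply/funext => n; rewrite integral_distribution//; last first.
    exact: (bounded_integrable_prob (G n) (M := M)).
  rewrite integral_distribution//; last first.
    exact: (bounded_integrable_prob (G n) (M := M)).
  apply: eq_integral => h _ /=; congr (f _)%:E.
  by rewrite /degree /natR /degree_nat; case: insubP.
exact: pgf_continuity.
Unshelve. all: by end_near.
Qed.
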